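(* Let $\mathbf w=w_0w_1w_2\cdots$ be a morphic infinite word over a finite alphabet $\Sigma$, and let $\Delta\subsetneq\Sigma$ be a nonempty subalphabet such that $\mathbf w$ contains infinitely many letters of $\overline\Delta=\Sigma\setminus\Delta$ and $\Delta$-blocks of unbounded length. For $k\ge0$ let $u^{(k)}=w_{i_k}\cdots w_{j_k}$ be the $k$-th maximal $\Delta$-block of $\mathbf w$. Then $\limsup_{k\to\infty}j_k/i_k$ is algebraic. If $\mathbf w$ is moreover automatic, then $\limsup_{k\to\infty}j_k/i_k$ is rational.
   Context: Positions are indexed from $0$. A factor $w_i\cdots w_j$ ($i\le j$) is a $\Delta$-block if all its letters lie in $\Delta$; it is maximal if moreover $w_{j+1}\in\overline\Delta$ and either $i=0$ or $w_{i-1}\in\overline\Delta$. Maximal $\Delta$-blocks are enumerated in increasing order of position. Morphic/automatic words: Let $\Sigma'$ be a finite alphabet. A morphism $h:\Sigma'^*\to\Sigma'^*$ is prolongable on $a$ if $h(a)=ax$ with $x$ nonempty and $h^n(x)$ nonempty for all $n\ge0$; then $h^\omega(a)=a\,x\,h(x)h^2(x)\cdots$ is a pure morphic word. A coding is a letter-to-letter morphism. An infinite word is morphic if it is the image under a coding of a pure morphic word, and automatic if it is the image under a coding of a pure morphic word $h^\omega(a)$ with $h$ uniform (all $|h(c)|$ equal). *)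

(* Defs.v *)
From Stdlib Require Import Reals ZArith List Arith.
Import ListNotations.
Open Scope R_scope.

Definition finite_type (T : Type) : Prop := exists l : list T, forall x, In x l.

Definition morph_apply {T : Type} (h : T -> list T) (u : list T) : list T :=
  flat_map h u.

Definition morph_iter {T : Type} (h : T -> list T) (n : nat) (u : list T) : list T :=
  Nat.iter n (morph_apply h) u.

Definition prolongable {T : Type} (h : T -> list T) (a : T) : Prop :=
  exists x : list T, h a = a :: x /\ forall n, morph_iter h n x <> [].

Definition is_fixed_point_word {T : Type} (h : T -> list T) (a : T) (z : nat -> T) : Prop :=
  prolongable h a /\
  forall n i, (i < length (morph_iter h n [a]))%nat -> z i = nth i (morph_iter h n [a]) a.

Definition uniform {T : Type} (h : T -> list T) : Prop :=
  exists m : nat, forall c, length (h c) = m.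

Definition morphic {A : Type} (w : nat -> A) : Prop :=
  exists (T : Type) (h : T -> list T) (a : T) (tau : T -> A) (z : nat -> T),
    finite_type T /\ is_fixed_point_word h a z /\ forall i, w i = tau (z i).

Definition automatic {A : Type} (w : nat -> A) : Prop :=
  exists (T : Type) (h : T -> list T) (a : T) (tau : T -> A) (z : nat -> T),
    finite_type T /\ uniform h /\ is_fixed_point_word h a z /\ forall i, w i = tau (z i).

Definition delta_block {A : Type} (w : nat -> A) (D : A -> bool) (i j : nat) : Prop :=
  (i <= j)%nat /\ forall p, (i <= p <= j)%nat -> D (w p) = true.

Definition max_delta_block {A : Type} (w : nat -> A) (D : A -> bool) (i j : nat) : Prop :=
  delta_block w D i j /\ D (w (S j)) = false /\ (i = 0%nat \/ D (w (pred i)) = false).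

Definition enumerates_max_blocks {A : Type} (w : nat -> A) (D : A -> bool)
    (bi bj : nat -> nat) : Prop :=
  (forall k, (bi k < bi (S k))%nat) /\
  (forall s t, max_delta_block w D s t <-> exists k, s = bi k /\ t = bj k).

Definition is_limsup (u : nat -> R) (L : R) : Prop :=
  (forall eps, eps > 0 -> exists N, forall k, (k >= N)%nat -> u k < L + eps) /\
  (forall eps, eps > 0 -> forall N, exists k, (k >= N)%nat /\ u k > L - eps).

Definition zpoly_eval (p : list Z) (x : R) : R :=
  fold_right (fun c acc => IZR c + x * acc) 0 p.

Definition algebraic (x : R) : Prop :=
  exists p : list Z, (exists c, In c p /\ c <> 0%Z) /\ zpoly_eval p x = 0.

Definition rational (x : R) : Prop :=
  exists p q : Z, q <> 0%Z /\ x = IZR p / IZR q.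

(* Main.v *)
(** Replacing [h] by a power, the set of letters whose images contain a letter outside [Delta]
does not depend on the exponent.  Two consecutive occurrences [P < Q] of such letters then
descend, [m] levels up, from positions [l <= l'] of the fixed point.  If [l < l'], both [P + 1]
and [Q] are weights of iterates of an auxiliary morphism, hence sequences [x M^m y] for a
nonnegative integer matrix [M].  If [l = l'] at a level [r] steps above the top, then
[Q - P = O(|h^(n-r)(a)|)] with [P >= |h^n(a)|].  Either [|h^n(a)|] grows subexponentially and
the limsup is [1], or a limsup larger than [1] only sees finitely many pairs [(l, l')], and is
an accumulation point of a ratio of two such sequences.

Once the power of [M] is chosen so that its support is idempotent, [x M^m y] is equivalent to
[c C(m, d) rho^m] with [c] algebraic: the entries of [M^m] are exponential polynomials by
Cayley-Hamilton, and the only peripheral eigenvalue is real.  Ratios of such sequences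
therefore have finitely many accumulation points, all algebraic.  For a uniform morphism of
length [mu] the sequences are [c mu^m + O(1)] with [c] rational, because each letter tracks at
most one other letter and such a chain is eventually periodic. *)
Require Import Defs.
From Stdlib Require Import Reals ZArith List Arith.
From Stdlib Require Import Bool Classical ClassicalEpsilon Lra Lia.
From mathcomp Require all_boot all_order all_algebra all_field ring lra zify ssrZ.
From mathcomp Require Rstruct.
Open Scope R_scope.

(** The block between consecutive letters outside [Delta] at [P < Q] occupies [P + 1, ..., Q - 1],
    so its ratio is [(Q - 1) / (P + 1)]. Following the last or first such letter of [h^m(c)] through
    the levels is linear only if the child that carries it is the same child at every level; this is
    what forces the passage to a power of [h].

    The auxiliary morphism has its own matrix, which needs a further power to get an idempotent
    support. That power is not applied to the word, so a ratio of weights converges only along each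
    residue class of [m]. Hence the result is one polynomial that kills all the limits, not one
    limit.

    These limits live in [algC], the limsup lives in [R], and no map between the two fields is used.
    The ratios themselves are rational, and so are the values of a rational polynomial at them; the
    statement that these values tend to 0 makes sense in both fields and is what is carried over.
    Continuity of the polynomial in [R] then makes the limsup a root. *)

Definition weight {T : Type} (v : T -> nat) (u : list T) : nat := list_sum (map v u).

Lemma morph_iter_app {T : Type} (h : T -> list T) m (u1 u2 : list T) :
  morph_iter h m (u1 ++ u2) = (morph_iter h m u1 ++ morph_iter h m u2)%list.
Proof.
  induction m as [|m IH]; [reflexivity|].
  unfold morph_iter in *; simpl; rewrite IH; apply flat_map_app.
Qed.

Lemma morph_iter_add {T : Type} (h : T -> list T) m n (u : list T) :
  morph_iter h (m + n) u = morph_iter h m (morph_iter h n u).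
Proof. apply Nat.iter_add. Qed.

Lemma morph_iter_succ {T : Type} (h : T -> list T) m (u : list T) :
  morph_iter h (S m) u = morph_iter h m (flat_map h u).
Proof. exact (Nat.iter_succ_r m _ (morph_apply h) u). Qed.

Lemma weight_app {T : Type} (v : T -> nat) u1 u2 :
  weight v (u1 ++ u2) = (weight v u1 + weight v u2)%nat.
Proof. unfold weight; rewrite map_app; apply list_sum_app. Qed.

(** * Asymptotics of powers of nonnegative integer matrices *)

Module MatrixGrowth.
Import all_boot all_order all_algebra all_field ring lra zify.
Import ssrZ Rstruct.
Import Order.TTheory GRing.Theory Num.Theory.
Local Open Scope ring_scope.
Set Implicit Arguments.
Unset Strict Implicit.
Unset Printing Implicit Defensive.

(** The order of [algC] is partial: [0 < e] says in particular that [e] is real, so this is the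
    usual limit. *)
Definition tends (f : nat -> algC) (l : algC) : Prop :=
  forall e, 0 < e -> exists N, forall m, (N <= m)%N -> `|f m - l| < e.

Lemma tends_cst c : tends (fun=> c) c.
Proof. by move=> e e0; exists 0%N => m _; rewrite subrr normr0. Qed.

Lemma tends_ext f g l N : (forall m, (N <= m)%N -> f m = g m) -> tends f l -> tends g l.
Proof.
move=> fg fl e e0; have [M HM] := fl e e0; exists (maxn N M) => m.
by rewrite geq_max => /andP[Nm Mm]; rewrite -fg//; apply: HM.
Qed.

Lemma tends_squeeze f g N :
  (forall m, (N <= m)%N -> `|f m| <= g m) -> tends g 0 -> tends f 0.
Proof.
move=> fg g0 e e0; have [M HM] := g0 e e0; exists (maxn N M) => m.
rewrite geq_max => /andP[Nm Mm]; rewrite subr0; apply: le_lt_trans (fg _ Nm) _.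
apply: le_lt_trans (HM _ Mm); rewrite subr0; apply: real_ler_norm.
exact: ger0_real (le_trans (normr_ge0 _) (fg _ Nm)).
Qed.

Lemma tendsD f g k l : tends f k -> tends g l -> tends (fun m => f m + g m) (k + l).
Proof.
move=> fk gl e e0; have e20 : 0 < e / 2%:R by rewrite divr_gt0 ?ltr0n.
have [M HM] := fk _ e20; have [N HN] := gl _ e20; exists (maxn M N) => m.
rewrite geq_max => /andP[Mm Nm]; rewrite opprD addrACA.
apply: le_lt_trans (ler_normD _ _) _.
by rewrite [e]splitr; apply: ltrD; [apply: HM|apply: HN].
Qed.

Lemma tendsZ c f l : tends f l -> tends (fun m => c * f m) (c * l).
Proof.
move=> fl e e0; have c0 : 0 < `|c| + 1 by rewrite ltr_wpDl.
have [N HN] := fl (e / (`|c| + 1)) (divr_gt0 e0 c0); exists N => m /HN.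
rewrite ltr_pdivlMr// => h; rewrite -mulrBr normrM; apply: le_lt_trans h.
by rewrite mulrC ler_wpM2l// lerDl.
Qed.

Lemma tendsB f g k l : tends f k -> tends g l -> tends (fun m => f m - g m) (k - l).
Proof.
move=> fk /(tendsZ (-1)) gl; rewrite -(mulN1r l).
by apply: (tends_ext (N := 0)) (tendsD fk gl) => m _; rewrite mulN1r.
Qed.

Lemma tends_bounded f l : tends f l ->
  exists2 C, 0 < C & exists N, forall m, (N <= m)%N -> `|f m| <= C.
Proof.
move=> fl; have [N HN] := fl 1 ltr01; exists (`|l| + 1); first by rewrite ltr_wpDl.
exists N => m /HN /ltW h; rewrite -(subrK l (f m)) addrC.
by apply: le_trans (ler_normD _ _) _; rewrite lerD2l.
Qed.

Lemma tendsM0 f g C N : (forall m, (N <= m)%N -> `|f m| <= C) -> tends g 0 ->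
  tends (fun m => f m * g m) 0.
Proof.
move=> fC /(tendsZ C); rewrite mulr0 => h.
apply: (tends_squeeze (N := N) (g := fun m => `|C * g m|)).
  move=> m /fC fmC; rewrite !normrM; apply: ler_wpM2r => //.
  exact: le_trans fmC (real_ler_norm (ger0_real (le_trans (normr_ge0 _) fmC))).
move=> e /h[M HM]; exists M => m /HM; by rewrite !subr0 normr_id.
Qed.

Lemma tendsM f g k l : tends f k -> tends g l -> tends (fun m => f m * g m) (k * l).
Proof.
move=> fk gl; have [C C0 [N HN]] := tends_bounded fk.
have gl0 : tends (fun m => g m - l) 0.
  by rewrite -(subrr l); apply: tendsB => //; apply: tends_cst.
have := tendsD (tendsM0 HN gl0) (tendsZ l fk); rewrite add0r mulrC.
by apply: (tends_ext (N := 0)) => m _; ring.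
Qed.

Lemma tendsV f l : l != 0 -> tends f l -> tends (fun m => (f m)^-1) l^-1.
Proof.
move=> l0 fl; have nl0 : 0 < `|l| by rewrite normr_gt0.
have [N HN] := fl _ (divr_gt0 nl0 (ltr0Sn _ 1)).
have lb m : (N <= m)%N -> `|l| / 2%:R <= `|f m|.
  move=> /HN/ltW h; have : `|l| <= `|f m| + `|l| / 2%:R.
    rewrite -{1}(subrK (f m) l) addrC; apply: le_trans (ler_normD _ _) _.
    by rewrite lerD2l distrC.
  by rewrite {1}[`|l|]splitr lerD2r.
have fl0 : tends (fun m => f m - l) 0.
  by rewrite -(subrr l); apply: tendsB => //; apply: tends_cst.
have b m : (N <= m)%N -> `|- (l^-1 * (f m)^-1)| <= `|l|^-1 * (`|l| / 2%:R)^-1.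
  move=> /lb h; rewrite normrN normrM !normfV ler_wpM2l ?invr_ge0//.
  by rewrite lef_pV2 ?posrE// ?divr_gt0 ?ltr0n//; apply: lt_le_trans h; rewrite divr_gt0 ?ltr0n.
have := tendsD (tendsM0 b fl0) (tends_cst l^-1); rewrite add0r.
apply: (tends_ext (N := N)) => m /lb h; field; rewrite l0 andbT.
by rewrite -normr_gt0; apply: lt_le_trans h; rewrite divr_gt0 ?ltr0n.
Qed.

Lemma tends_uniq f k l : tends f k -> tends f l -> k = l.
Proof.
move=> fk fl; apply/eqP; rewrite -subr_eq0 -normr_le0; apply/negP => /negP.
rewrite -real_ltNge ?real0// ?normr_real// => e0.
have [N HN] := tendsB fk fl e0.
by have := HN N (leqnn N); rewrite subrr sub0r normrN ltxx.
Qed.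

Lemma tends_ge0 f l N : (forall m, (N <= m)%N -> 0 <= f m) -> tends f l -> 0 <= l.
Proof.
move=> f0 fl; suff -> : l = `|l| by [].
apply: (tends_uniq fl); move=> e /fl[M HM]; exists (maxn N M) => m.
rewrite geq_max => /andP[/f0 fm /HM]; rewrite -{2}(ger0_norm fm).
by apply: le_lt_trans; apply: ler_dist_dist.
Qed.

Lemma tends_sum (I : finType) (f : I -> nat -> algC) (l : I -> algC) :
  (forall i, tends (f i) (l i)) -> tends (fun m => \sum_i f i m) (\sum_i l i).
Proof.
move=> fl; elim: (index_enum I) => [|i s IH].
  by apply: (tends_ext (N := 0)) (tends_cst _) => m _; rewrite !big_nil.
rewrite big_cons; apply: (tends_ext (N := 0)) (tendsD (fl i) IH) => m _.
by rewrite big_cons.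
Qed.

Lemma tends_shift k f l : tends f l -> tends (fun m => f (m + k)%N) l.
Proof.
move=> fl e /fl[N HN]; exists N => m Nm; apply: HN.
exact: leq_trans Nm (leq_addr _ _).
Qed.

Lemma tends_unshift k f l : tends (fun m => f (m + k)%N) l -> tends f l.
Proof.
move=> fl e /fl[N HN]; exists (N + k)%N => m Nm.
by have := HN (m - k)%N; rewrite subnK; [apply; lia|lia].
Qed.

Lemma tends_invn : tends (fun m => m.+1%:R^-1) 0.
Proof.
move=> e e0; have /archi_boundP : 0 <= e^-1 by rewrite invr_ge0 ltW.
set N := Num.Def.archi_bound _ => h; exists N => m Nm.
rewrite subr0 normfV normr_nat invf_plt ?posrE ?ltr0Sn//; apply: lt_le_trans h _.
by rewrite ler_nat; apply: leq_trans Nm _.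
Qed.

Lemma bin_gt0r m e : (e <= m)%N -> 0 < 'C(m, e)%:R :> algC.
Proof. by move=> em; rewrite ltr0n bin_gt0. Qed.

(** From [(e + 1) C(n, e + 1) = (n - e) C(n, e)] the ratio at [n = m + e + 1] is exactly
    [(e + 1) / (m + 1)]. *)
Lemma bin_ratioS_tends0 e : tends (fun m => 'C(m, e)%:R / 'C(m, e.+1)%:R) 0.
Proof.
apply: (tends_unshift (k := e.+1)).
have := tendsZ e.+1%:R tends_invn; rewrite mulr0.
apply: (tends_ext (N := 0)) => m _.
have := mul_bin_left (m + e.+1) e; rewrite (_ : (m + e.+1 - e = m.+1)%N); last by lia.
move=> /(congr1 (fun n => n%:R : algC)); rewrite !natrM => h.
have b0 := lt0r_neq0 (bin_gt0r (leq_addl m e.+1)).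
have m0 : m.+1%:R != 0 :> algC by rewrite pnatr_eq0.
by apply/eqP; rewrite eqr_div// h mulrC.
Qed.

Lemma bin_ratio_tends0 d e : (d < e)%N ->
  tends (fun m => 'C(m, d)%:R / 'C(m, e)%:R) 0.
Proof.
elim: e => // e IH; rewrite ltnS leq_eqVlt => /orP[/eqP ->{d IH}|de].
  exact: bin_ratioS_tends0.
have := tendsM (IH de) (bin_ratioS_tends0 e); rewrite mulr0.
apply: (tends_ext (N := e)) => m em.
by rewrite -mulrA [X in _ * X]mulrA mulVf ?mul1r// lt0r_neq0// bin_gt0r.
Qed.

(** Write [|r| = 1 / (1 + x)]. One term of the binomial expansion gives
    [(1 + x)^m >= C(m, k + 1) x^(k + 1)], which leaves the ratio [C(m, k) / C(m, k + 1)]. *)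
Lemma bin_expr_tends0 k r : `|r| < 1 -> tends (fun m => 'C(m, k)%:R * r ^+ m) 0.
Proof.
have [->|r0] := eqVneq r 0.
  move=> _; apply: (tends_ext (N := 1)) (tends_cst 0) => m m0.
  by rewrite expr0n gtn_eqF// mulr0.
rewrite -normr_gt0 in r0; move=> r1.
have [x x0 xE] : exists2 x, 0 < x & `|r| = (1 + x)^-1.
  by exists (`|r|^-1 - 1); rewrite ?subr_gt0 ?invf_gt1// addrC subrK invrK.
have := tendsZ (x ^+ k.+1)^-1 (bin_ratioS_tends0 k); rewrite mulr0.
apply: (tends_squeeze (N := k.+1)) => m km.
rewrite normrM normr_nat normrX xE exprVn -exprVn exprVn mulrCA; apply: ler_wpM2l => //.
rewrite -invfM lef_pV2 ?posrE ?mulr_gt0 ?exprn_gt0 ?bin_gt0r//; last by rewrite addr_gt0.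
rewrite exprDn (bigD1 (inord k.+1)) //= inordK ?ltnS//.
rewrite expr1n mul1r mulr_natr lerDl sumr_ge0// => i _.
by rewrite mulrn_wge0// mulr_ge0 ?exprn_ge0 ?ler01// ltW.
Qed.

(** * Growth scales and sequences asymptotic to them *)

Definition growth d (rho : algC) m : algC := 'C(m, d)%:R * rho ^+ m.

Lemma growth_ge0 d rho m : 0 <= rho -> 0 <= growth d rho m.
Proof. by move=> r0; rewrite mulr_ge0 ?exprn_ge0. Qed.

Lemma growth_gt0 d rho m : 0 < rho -> (d <= m)%N -> 0 < growth d rho m.
Proof. by move=> r0 dm; rewrite mulr_gt0 ?exprn_gt0// bin_gt0r. Qed.

Lemma growth_lt_base d e rho sigma : 0 <= rho -> rho < sigma ->
  tends (fun m => growth d rho m / growth e sigma m) 0.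
Proof.
move=> r0 rs; have s0 := le_lt_trans r0 rs.
have h : `|rho / sigma| < 1 by rewrite ger0_norm ?divr_ge0 ?(ltW s0)// ltr_pdivrMr// mul1r.
apply: (tends_squeeze (N := e) _ (bin_expr_tends0 d h)) => m em.
rewrite ger0_norm ?divr_ge0 ?growth_ge0 ?(ltW s0)//.
rewrite /growth exprMn exprVn mulrA invfM mulrA -!mulrA ler_wpM2l ?ler0n//.
rewrite ler_wpM2l ?exprn_ge0// -[leRHS]mul1r ler_wpM2r ?invr_ge0 ?exprn_ge0 ?(ltW s0)//.
by rewrite invf_le1 ?bin_gt0r// ler1n bin_gt0.
Qed.

Lemma growth_lt_exp d e rho : 0 < rho -> (d < e)%N ->
  tends (fun m => growth d rho m / growth e rho m) 0.
Proof.
move=> r0 /bin_ratio_tends0; apply: (tends_ext (N := 0)) => m _.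
by rewrite /growth -mulf_div divff ?mulr1// expf_neq0// lt0r_neq0.
Qed.

Definition asy (f : nat -> algC) rho d c : Prop :=
  [/\ 0 < rho, 0 < c & tends (fun m => f m / growth d rho m) c].

(** Eventual vanishing is a separate case because [asy] asks for a positive constant. Positivity is
    what makes the class closed under sums: leading terms never cancel. *)
Definition regular (f : nat -> algC) : Prop :=
  (exists N, forall m, (N <= m)%N -> f m = 0) \/ exists rho d c, asy f rho d c.

Lemma growth_trichotomy d e rho sigma : 0 < rho -> 0 < sigma ->
  [\/ rho = sigma /\ d = e,
      tends (fun m => growth d rho m / growth e sigma m) 0 |
      tends (fun m => growth e sigma m / growth d rho m) 0].
Proof.
move=> r0 s0.
have [rs|sr|<-] := real_ltgtP (gtr0_real r0) (gtr0_real s0).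
- by apply: Or32; apply: growth_lt_base => //; apply: ltW.
- by apply: Or33; apply: growth_lt_base => //; apply: ltW.
have [de|ed|<-] := ltngtP d e; last by apply: Or31.
- by apply: Or32; apply: growth_lt_exp.
- by apply: Or33; apply: growth_lt_exp.
Qed.

Lemma asyD_small f g rho d c sigma e c' : asy f rho d c -> asy g sigma e c' ->
  tends (fun m => growth d rho m / growth e sigma m) 0 ->
  asy (fun m => f m + g m) sigma e c'.
Proof.
move=> [r0 c0 fc] [s0 c0' gc'] h; split => //.
have := tendsD (tendsM fc h) gc'; rewrite mulr0 add0r.
apply: (tends_ext (N := d)) => m dm.
by rewrite mulrA divfK ?mulrDl// lt0r_neq0// growth_gt0.
Qed.

Lemma asy_ext f g N rho d c : (forall m, (N <= m)%N -> f m = g m) ->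
  asy f rho d c -> asy g rho d c.
Proof.
by move=> fg [r0 c0 h]; split=> //; apply: tends_ext h => m /fg ->.
Qed.

Lemma regular_ext f g N : (forall m, (N <= m)%N -> f m = g m) -> regular f -> regular g.
Proof.
move=> fg [[M h]|[rho [d [c h]]]]; last first.
  by right; exists rho, d, c; apply: (asy_ext fg) h.
left; exists (maxn M N) => m; rewrite geq_max => /andP[Mm Nm].
by rewrite -fg// h.
Qed.

Lemma regularD f g : regular f -> regular g -> regular (fun m => f m + g m).
Proof.
move=> [[N fN]|[rho [d [c fA]]]].
  by apply: (regular_ext (N := N)) => m /fN ->; rewrite add0r.
move=> [[N gN]|[sigma [e [c' gA]]]].
  right; exists rho, d, c; apply: (asy_ext (N := N)) fA => m Nm /=; by rewrite gN ?addr0.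
right; have [r0 c0 fc] := fA; have [s0 c0' gc] := gA.
have [[rs de]|h|h] := growth_trichotomy d e r0 s0.
- subst sigma e; exists rho, d, (c + c'); split; rewrite ?addr_gt0//.
  by apply: (tends_ext (N := 0)) (tendsD fc gc) => m _; rewrite mulrDl.
- by exists sigma, e, c'; apply: asyD_small fA gA h.
- exists rho, d, c; apply: (asy_ext (N := 0)) (asyD_small gA fA h) => m _; exact: addrC.
Qed.

Lemma regularZ c f : 0 <= c -> regular f -> regular (fun m => c * f m).
Proof.
rewrite le_eqVlt => /orP[/eqP <- _|c0].
  by left; exists 0%N => m _; rewrite mul0r.
move=> [[N h]|[rho [d [k [r0 k0 h]]]]].
  by left; exists N => m /h ->; rewrite mulr0.
right; exists rho, d, (c * k); split; rewrite ?mulr_gt0//.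
by apply: (tends_ext (N := 0)) (tendsZ c h) => m _; rewrite mulrA.
Qed.

Lemma regular_sum (I : finType) (f : I -> nat -> algC) :
  (forall i, regular (f i)) -> regular (fun m => \sum_i f i m).
Proof.
move=> fr; elim: (index_enum I) => [|i s IH].
  by left; exists 0%N => m _; rewrite big_nil.
by apply: (regular_ext (N := 0)) (regularD (fr i) IH) => m _; rewrite big_cons.
Qed.

(** Any two scales are comparable, so [f / g] tends to a quotient of constants, to 0, or to
    infinity; the bound by [C] excludes the last case. *)
Lemma regular_ratio f g C : regular f -> regular g ->
  (forall m, 0 < g m) -> (forall m, `|f m| <= C * g m) ->
  exists c, tends (fun m => f m / g m) c.
Proof.
move=> [[N fN]|[rho [d [c [r0 c0 fc]]]]].
  move=> _ _ _; exists 0; apply: (tends_ext (N := N)) (tends_cst 0) => m /fN ->.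
  by rewrite mul0r.
move=> [[N gN] g0|[sigma [e [c' [s0 c0' gc]]]] g0 fg].
  by have := g0 N; rewrite gN ?ltxx.
have gcV := tendsV (lt0r_neq0 c0') gc.
have fgE m : (maxn d e <= m)%N ->
    f m / g m = f m / growth d rho m * (g m / growth e sigma m)^-1 *
                (growth d rho m / growth e sigma m).
  rewrite geq_max => /andP[/(growth_gt0 r0)/lt0r_neq0 A /(growth_gt0 s0)/lt0r_neq0 B].
  by field; rewrite A B lt0r_neq0.
have [[rs de]|h|h] := growth_trichotomy d e r0 s0.
- subst sigma e; exists (c / c').
  have := tendsM fc gcV; apply: (tends_ext (N := d)) => m dm.
  by rewrite fgE ?maxnn// divff ?mulr1// lt0r_neq0// growth_gt0.
- exists 0; have := tendsM (tendsM fc gcV) h; rewrite mulr0.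
  by apply: (tends_ext (N := maxn d e)) => m /fgE ->.
(* Here the scale of [f] dominates that of [g]: a bounded [f / g] would force [f / growth d rho] to
   tend to 0 instead of [c > 0]. *)
- exfalso; have fgC m : (0 <= m)%N -> `|f m / g m| <= C.
    by move=> _; rewrite normrM normfV (gtr0_norm (g0 m)) ler_pdivrMr.
  have gh := tendsM gc h; rewrite mulr0 in gh.
  suff /(tends_uniq fc)/eqP : tends (fun m => f m / growth d rho m) 0.
    by rewrite (gt_eqF c0).
  apply: (tends_ext (N := maxn d e)) (tendsM0 fgC gh) => m.
  rewrite geq_max => /andP[/(growth_gt0 r0)/lt0r_neq0 A /(growth_gt0 s0)/lt0r_neq0 B].
  by field; rewrite A B lt0r_neq0.
Qed.

Lemma growth_ratioS d rho : 0 < rho ->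
  tends (fun m => growth d rho m.+1 / growth d rho m) rho.
Proof.
move=> r0; have : tends (fun m => 'C(m.+1, d)%:R / 'C(m, d)%:R) 1.
  case: d => [|d].
    apply: (tends_ext (N := 0)) (tends_cst 1) => m _.
    by rewrite !bin0 divr1.
  have := tendsD (tends_cst 1) (bin_ratioS_tends0 d); rewrite addr0.
  apply: (tends_ext (N := d.+1)) => m dm.
  by rewrite binS natrD mulrDl divff// lt0r_neq0// bin_gt0r.
move=> /(tendsZ rho); rewrite mulr1; apply: (tends_ext (N := d)) => m dm.
have A := lt0r_neq0 (exprn_gt0 m r0); have B := lt0r_neq0 (bin_gt0r dm).
by rewrite /growth exprS; field; rewrite ?A ?B ?lt0r_neq0.
Qed.

Lemma asy_unshift f rho d c : asy (fun m => f m.+1) rho d c -> asy f rho d (c / rho).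
Proof.
move=> [r0 c0 h]; split=> //; first by rewrite divr_gt0.
apply: (tends_unshift (k := 1)).
have := tendsM h (tendsV (lt0r_neq0 r0) (growth_ratioS d r0)).
apply: (tends_ext (N := d)) => m dm; rewrite addn1.
have A := lt0r_neq0 (growth_gt0 r0 dm).
have B := lt0r_neq0 (growth_gt0 r0 (leqW dm)).
by field; rewrite A B.
Qed.

Lemma asy_ratioS f rho d c : asy f rho d c -> tends (fun m => f m.+1 / f m) rho.
Proof.
move=> [r0 c0 fc].
have f1 := tends_shift 1 fc; have fV := tendsV (lt0r_neq0 c0) fc.
have := tendsM (tendsM f1 fV) (growth_ratioS d r0); rewrite divff ?lt0r_neq0// mul1r.
have [N HN] : exists N, forall m, (N <= m)%N -> f m != 0.
  have [N HN] := fc _ c0; exists N => m /HN; apply: contraTneq => ->.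
  by rewrite mul0r sub0r normrN (gtr0_norm c0) ltxx.
apply: (tends_ext (N := maxn N d)) => m; rewrite geq_max => /andP[/HN fm dm].
rewrite addn1; have A := lt0r_neq0 (growth_gt0 r0 dm).
have B := lt0r_neq0 (growth_gt0 r0 (leqW dm)).
by field; rewrite A B fm.
Qed.

(** * Exponential polynomials and entries of matrix powers *)

(** These are the entries of the powers of a Jordan block. The exponent [m - k] covers the
    eigenvalue 0 as well: [bexp k 0] is the indicator of [m = k]. *)
Definition bexp k (r : algC) m : algC := 'C(m, k)%:R * r ^+ (m - k).

Lemma bexp0S (r s : algC) m : bexp 0 s m.+1 - r * bexp 0 s m = (s - r) * bexp 0 s m.
Proof. by rewrite /bexp !bin0 !subn0 exprS; ring. Qed.

Lemma bexpSS k (r s : algC) m :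
  bexp k.+1 s m.+1 - r * bexp k.+1 s m = (s - r) * bexp k.+1 s m + bexp k s m.
Proof.
rewrite /bexp binS natrD subSS; have [km|mk] := ltnP k m.
  by rewrite (_ : (m - k = (m - k.+1).+1)%N) ?exprS; [ring|lia].
by rewrite (bin_small (n := m) (m := k.+1))//; ring.
Qed.

(** Linear combinations of the [bexp k r] with [r] in [rs] and no bound on [k]. The equations are
    pointwise, so that functional extensionality does not intervene. *)
Inductive expoly (rs : seq algC) : (nat -> algC) -> Prop :=
| expoly0 f : (forall m, f m = 0) -> expoly rs f
| expolyD c k r g f : r \in rs -> expoly rs g ->
    (forall m, f m = c * bexp k r m + g m) -> expoly rs f.

Lemma expoly_ext rs f g : (forall m, f m = g m) -> expoly rs f -> expoly rs g.
Proof.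
move=> fg fE; case: fE fg => [f' f0 fg|c k r g' f' rrs g'E f'E fg].
  by apply: expoly0 => m; rewrite -fg.
by apply: (expolyD (c := c) (k := k) rrs g'E) => m; rewrite -fg.
Qed.

Lemma expoly_add rs f g : expoly rs f -> expoly rs g -> expoly rs (fun m => f m + g m).
Proof.
move=> fE gE; elim: fE => [f0 f00|c k r g' f' rrs g'E IH f'E].
  by apply: expoly_ext gE => m; rewrite f00 add0r.
by apply: (expolyD (c := c) (k := k) rrs IH) => m; rewrite f'E addrA.
Qed.

Lemma expoly_scale rs a f : expoly rs f -> expoly rs (fun m => a * f m).
Proof.
elim=> [f0 f00|c k r g' f' rrs g'E IH f'E].
  by apply: expoly0 => m; rewrite f00 mulr0.
by apply: (expolyD (c := a * c) (k := k) rrs IH) => m; rewrite f'E; ring.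
Qed.

Lemma expoly_bexp rs k r : r \in rs -> expoly rs (bexp k r).
Proof.
move=> rrs; apply: (expolyD (c := 1) (k := k) rrs (@expoly0 rs (fun=> 0) _)) => // m.
by rewrite mul1r addr0.
Qed.

Lemma expoly_sum rs (I : finType) (f : I -> nat -> algC) :
  (forall i, expoly rs (f i)) -> expoly rs (fun m => \sum_i f i m).
Proof.
move=> fr; elim: (index_enum I) => [|i s IH].
  by apply: expoly0 => m; rewrite big_nil.
by apply: expoly_ext (expoly_add (fr i) IH) => m; rewrite big_cons.
Qed.

Lemma expoly_sub rs rs' f : {subset rs <= rs'} -> expoly rs f -> expoly rs' f.
Proof.
move=> sub; elim=> [f0 f00|c k r g' f' rrs g'E IH f'E]; first exact: expoly0.
exact: (expolyD (sub _ rrs) IH f'E).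
Qed.

(** In the resonant case [r = s] Pascal's rule raises the degree by one; otherwise [s - r] is
    inverted and the lower term is removed by induction on [k]. *)
Lemma bexp_particular rs r s k : r \in rs -> s \in rs ->
  exists2 u, expoly rs u & forall m, u m.+1 - r * u m = bexp k s m.
Proof.
move=> rrs srs; have [->|rs'] := eqVneq r s.
  exists (bexp k.+1 s); first exact: expoly_bexp.
  by move=> m; rewrite bexpSS subrr mul0r add0r.
have sr0 : s - r != 0 by rewrite subr_eq0 eq_sym.
elim: k => [|k [u uE uP]].
  exists (fun m => (s - r)^-1 * bexp 0 s m); first exact/expoly_scale/expoly_bexp.
  by move=> m; rewrite [r * _]mulrCA -mulrBr bexp0S mulKf.
exists (fun m => (s - r)^-1 * (bexp k.+1 s m + -1 * u m)).
  by apply/expoly_scale/expoly_add; [apply: expoly_bexp|apply: expoly_scale].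
move=> m; rewrite [r * _]mulrCA -mulrBr.
have -> : bexp k.+1 s m.+1 + -1 * u m.+1 - r * (bexp k.+1 s m + -1 * u m) =
  (bexp k.+1 s m.+1 - r * bexp k.+1 s m) - (u m.+1 - r * u m) by ring.
by rewrite bexpSS uP addrK mulKf.
Qed.

Lemma expoly_solve rs r f g : r \in rs -> expoly rs g ->
  (forall m, f m.+1 - r * f m = g m) -> expoly rs f.
Proof.
move=> rrs gE fg.
have [u uE uP] : exists2 u, expoly rs u & forall m, u m.+1 - r * u m = g m.
  elim: gE {fg} => [g0 g00|c k s g' g0 srs g'E [v vE vP] g0E].
    by exists (fun=> 0); [apply: expoly0|move=> m; rewrite g00 mulr0 subr0].
  have [w wE wP] := bexp_particular k rrs srs.
  exists (fun m => c * w m + v m); first exact/expoly_add/vE/expoly_scale.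
  by move=> m; rewrite g0E -wP -vP; ring.
apply: (expoly_ext (f := fun m => u m + (f 0%N - u 0%N) * bexp 0 r m)); last first.
  by apply/(expoly_add uE)/expoly_scale/expoly_bexp.
elim=> [|m IH]; first by rewrite /bexp bin0 expr0; ring.
have -> : f m.+1 = g m + r * f m by rewrite -fg subrK.
have -> : u m.+1 = g m + r * u m by rewrite -uP subrK.
rewrite -IH; have -> : bexp 0 r m.+1 = r * bexp 0 r m.
  by rewrite /bexp !bin0 !subn0 exprS; ring.
ring.
Qed.

(** Peeling one factor [X - r] off the annihilating product replaces [Y] by [(A - r) Y], and
    [f m = (A ^+ m * Y) i j] satisfies [f (m + 1) - r f m = (A ^+ m * ((A - r) Y)) i j]. Hence the
    generality in [Y]. *)
Lemma expoly_mx_annul n (A : 'M[algC]_n.+1) rs (Y : 'M[algC]_n.+1) i j :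
  horner_mx A (\prod_(r <- rs) ('X - r%:P)) * Y = 0 ->
  expoly rs (fun m => (A ^+ m * Y) i j).
Proof.
elim: rs Y => [|r rs IH] Y.
  rewrite big_nil rmorph1 mul1r => ->.
  by apply: expoly0 => m; rewrite mulr0 mxE.
rewrite big_cons mulrC rmorphM /= -mulrA => /IH H.
apply: (expoly_solve (mem_head r rs)).
  by apply: expoly_sub H => x; rewrite inE orbC => ->.
move=> m; rewrite rmorphB /= horner_mx_X horner_mx_C exprSr mulrBl mulrBr mulrA.
have -> : r%:M * Y = r *: Y by rewrite -mulmxE mul_scalar_mx.
have mxBZ (X Z : 'M[algC]_n.+1) : (X - r *: Z) i j = X i j - r * Z i j by rewrite !mxE.
by rewrite -scalerAr mxBZ.
Qed.

Lemma expoly_mx n (A : 'M[algC]_n.+1) :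
  exists2 rs, (forall r, r \in rs = root (char_poly A) r) &
    forall i j, expoly rs (fun m => (A ^+ m) i j).
Proof.
have [rs rsE] := closed_field_poly_normal (char_poly A).
rewrite (monicP (char_poly_monic A)) scale1r in rsE.
exists rs; first by move=> r; rewrite rsE root_prod_XsubC.
move=> i j; apply: (expoly_ext (f := fun m => (A ^+ m * 1) i j)).
  by move=> m; rewrite mulr1.
by apply: expoly_mx_annul; rewrite -rsE Cayley_Hamilton mul0r.
Qed.

Lemma bexpE k r m : r != 0 -> bexp k r m = r ^- k * ('C(m, k)%:R * r ^+ m).
Proof.
move=> r0; rewrite /bexp mulrCA; have [km|mk] := leqP k m; last by rewrite bin_small// !mul0r.
have -> : r ^+ m = r ^+ (m - k) * r ^+ k by rewrite -exprD subnK.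
by rewrite [X in _ = _ * X]mulrC mulfK// expf_neq0.
Qed.

Lemma bexp_small k r s : `|r| < s -> tends (fun m => bexp k r m / s ^+ m) 0.
Proof.
move=> rs; have s0 := le_lt_trans (normr_ge0 r) rs.
have [->|r0] := eqVneq r 0.
  apply: (tends_ext (N := k.+1)) (tends_cst 0) => m km.
  by rewrite /bexp expr0n subn_eq0 leqNgt km/= mulr0 mul0r.
have h : `|r / s| < 1 by rewrite normrM normfV (gtr0_norm s0) ltr_pdivrMr// mul1r.
have := tendsZ (r ^- k) (bin_expr_tends0 k h); rewrite mulr0.
by apply: (tends_ext (N := 0)) => m _; rewrite bexpE// expr_div_n; ring.
Qed.

Lemma expoly_small rs f s : expoly rs f -> (forall r, r \in rs -> `|r| < s) ->
  tends (fun m => f m / s ^+ m) 0.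
Proof.
move=> fE rs_s; elim: fE => [f0 f00|c k r g' f' rrs g'E IH f'E].
  by apply: (tends_ext (N := 0)) (tends_cst 0) => m _; rewrite f00 mul0r.
have := tendsD (tendsZ c (bexp_small k (rs_s _ rrs))) IH; rewrite mulr0 addr0.
by apply: (tends_ext (N := 0)) => m _; rewrite f'E mulrDl mulrA.
Qed.

(** The coefficients of [q] are taken in the basis ['C(m, k)], which vanishes for [k > m]. *)
Definition binpoly (q : {poly algC}) m : algC := \sum_(k < m.+1) q`_k * 'C(m, k)%:R.

Lemma binpolyDXn q c k m :
  binpoly (c *: 'X^k + q) m = c * 'C(m, k)%:R + binpoly q m.
Proof.
rewrite /binpoly (eq_bigr (fun i : 'I_m.+1 => c * (val i == k)%:R * 'C(m, i)%:R + q`_i * 'C(m, i)%:R)).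
  rewrite big_split/=; congr (_ + _); have [km|mk] := ltnP k m.+1.
    rewrite (bigD1 (Ordinal km))//= eqxx mulr1 big1 ?addr0// => i.
    by rewrite -val_eqE/= => /negPf ->; rewrite mulr0 mul0r.
  rewrite bin_small// mulr0 big1// => i _; rewrite ltn_eqF ?mulr0 ?mul0r//.
  exact: leq_trans (ltn_ord i) mk.
by move=> i _; rewrite coefD coefZ coefXn mulrDl.
Qed.

(** After division by [rho ^+ m] every base of smaller modulus vanishes in the limit, and the base
    [rho] leaves a polynomial in [m]. *)
Lemma expoly_dominant rs f rho : expoly rs f -> 0 < rho ->
  (forall r, r \in rs -> r = rho \/ `|r| < rho) ->
  exists q, tends (fun m => f m / rho ^+ m - binpoly q m) 0.
Proof.
move=> fE r0 rsP; elim: fE => [f0 f00|c k r g' f' /rsP rr g'E [q IH] f'E].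
  exists 0; apply: (tends_ext (N := 0)) (tends_cst 0) => m _.
  by rewrite f00 mul0r /binpoly big1 ?subr0// => i _; rewrite coef0 mul0r.
case: rr => [rE|r_lt].
  rewrite {}rE in f'E; exists ((c * rho ^- k) *: 'X^k + q); apply: (tends_ext (N := 0)) IH => m _.
  rewrite binpolyDXn f'E bexpE ?lt0r_neq0//; field.
  by rewrite !expf_neq0// lt0r_neq0.
exists q; have := tendsD (tendsZ c (bexp_small k r_lt)) IH; rewrite mulr0 addr0.
by apply: (tends_ext (N := 0)) => m _; rewrite f'E; ring.
Qed.

Lemma binpoly_lead q : q != 0 ->
  tends (fun m => binpoly q m / 'C(m, (size q).-1)%:R) (lead_coef q).
Proof.
move=> q0; set d := (size q).-1; have dS : size q = d.+1 by rewrite prednK// lt0n size_poly_eq0.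
have H (k : 'I_d.+1) : tends (fun m => q`_k * ('C(m, k)%:R / 'C(m, d)%:R))
    (if k == ord_max then lead_coef q else 0).
  have [->|kd] := eqVneq k ord_max.
    rewrite /= -/d -[X in tends _ X]mulr1; apply: tendsZ.
    apply: (tends_ext (N := d)) (tends_cst 1) => m dm.
    by rewrite divff// lt0r_neq0// bin_gt0r.
  rewrite -[X in tends _ X](mulr0 q`_k); apply/tendsZ/bin_ratio_tends0.
  by move: kd; rewrite -val_eqE/= => kd; rewrite ltn_neqAle kd -ltnS/=.
have := tends_sum H; rewrite -big_mkcond big_pred1_eq.
apply: (tends_ext (N := d)) => m dm.
rewrite /binpoly mulr_suml (big_ord_widen m.+1 (fun k => q`_k * ('C(m, k)%:R / 'C(m, d)%:R)))//.
rewrite big_mkcond; apply: eq_bigr => i _; rewrite mulrA; case: ltnP => // di.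
by rewrite nth_default ?dS// !mul0r.
Qed.

(** The lower bound rules out that the terms in [rho] cancel, i.e. that [q = 0]; the leading
    coefficient is then positive as a nonzero limit of nonnegative numbers. *)
Lemma expoly_asy rs f rho c0 N : expoly rs f -> 0 < rho ->
  (forall r, r \in rs -> r = rho \/ `|r| < rho) ->
  0 < c0 -> (forall m, (N <= m)%N -> c0 * rho ^+ m <= f m) ->
  exists d c, asy f rho d c.
Proof.
move=> fE r0 rsP c00 fge; have [q qP] := expoly_dominant fE r0 rsP.
have fge' m : (N <= m)%N -> c0 <= f m / rho ^+ m.
  by move=> /fge h; rewrite ler_pdivlMr// exprn_gt0.
have q0 : q != 0.
  apply/eqP => q0; have [M HM] := qP _ c00.
  have := HM (maxn M N) (leq_maxl _ _).
  have -> : binpoly q (maxn M N) = 0.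
    by rewrite q0 /binpoly big1// => i _; rewrite coef0 mul0r.
  rewrite !subr0.
  have h := fge' _ (leq_maxr M N).
  by rewrite ger0_norm ?(le_trans (ltW c00) h)// => /(le_lt_trans h); rewrite ltxx.
set d := (size q).-1.
have qi : tends (fun m => 'C(m, d)%:R^-1 * (f m / rho ^+ m - binpoly q m)) 0.
  apply: (tendsM0 (C := 1) (N := d)) qP => m dm.
  by rewrite normfV normr_nat invf_le1 ?bin_gt0r// ler1n bin_gt0.
have := tendsD qi (binpoly_lead q0); rewrite add0r => H.
have H' : tends (fun m => f m / growth d rho m) (lead_coef q).
  apply: (tends_ext (N := d)) H => m dm.
  rewrite -/d /growth; field.
  by rewrite ?(lt0r_neq0 (bin_gt0r dm)) ?expf_neq0// lt0r_neq0.
exists d, (lead_coef q); split=> //.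
rewrite lt_neqAle eq_sym lead_coef_eq0 q0/=; apply: (tends_ge0 (N := maxn N d)) H' => m.
rewrite geq_max => /andP[/fge' h dm]; rewrite /growth mulrC invfM -mulrA mulr_ge0 ?invr_ge0//.
by rewrite mulrC; apply: le_trans h; apply: ltW.
Qed.

Lemma max_norm_seq (rs : seq algC) r0 : r0 \in rs ->
  exists2 lam, lam \in rs & forall r, r \in rs -> `|r| <= `|lam|.
Proof.
elim: rs r0 => // r rs IH r0 _; case: rs IH => [_|r' rs /(_ r' (mem_head _ _))[lam lamrs lamP]].
  by exists r; rewrite ?mem_head// => s; rewrite inE => /eqP ->.
have [rlam|lamr] := real_leP (normr_real r) (normr_real lam).
  by exists lam => [|s]; rewrite inE ?lamrs ?orbT// => /orP[/eqP ->|/lamP].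
exists r => [|s]; rewrite ?mem_head// inE => /orP[/eqP ->//|/lamP].
by move=> /le_trans; apply; apply: ltW.
Qed.

(** * Perron-Frobenius theory for idempotent supports *)

Section NonnegativeMatrices.
Variable n : nat.
Implicit Types A B N : 'M[algC]_n.+1.

(** The gap between 0 and 1 stands in for integrality: it passes to products, so every nonzero entry
    of a power is at least 1. *)
Definition natmx A : Prop := forall i j, A i j = 0 \/ 1 <= A i j.

Lemma natmx_ge0 A i j : natmx A -> 0 <= A i j.
Proof. by move=> /(_ i j)[->//|/(le_trans ler01)]. Qed.

Lemma natmx_ge1 A i j : natmx A -> A i j != 0 -> 1 <= A i j.
Proof. by move=> /(_ i j)[->|//]; rewrite eqxx. Qed.

Lemma mxmulE A B i j : (A * B) i j = \sum_k A i k * B k j.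
Proof. by rewrite -mulmxE mxE. Qed.

Lemma natmx_mul_neq0 A B i j : natmx A -> natmx B ->
  reflect (exists2 k, A i k != 0 & B k j != 0) ((A * B) i j != 0).
Proof.
move=> nA nB; rewrite mxmulE psumr_neq0; last first.
  by move=> k _; rewrite mulr_ge0 ?natmx_ge0.
apply: (iffP hasP) => [[k _ /= /lt0r_neq0]|[k Ak Bk]].
  by rewrite mulf_eq0 negb_or => /andP[]; exists k.
exists k; first exact: mem_index_enum.
by rewrite /= mulr_gt0// lt_neqAle eq_sym ?Ak ?Bk natmx_ge0.
Qed.

Lemma natmx_mul A B : natmx A -> natmx B -> natmx (A * B).
Proof.
move=> nA nB i j; have [->|/natmx_mul_neq0] := eqVneq ((A * B) i j) 0; first by left.
move=> /(_ nA nB)[k Ak Bk]; right; rewrite mxmulE (bigD1 k)//= -[leLHS]addr0 lerD//.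
  by rewrite mulr_ege1// natmx_ge1.
by rewrite sumr_ge0// => k' _; rewrite mulr_ge0 ?natmx_ge0.
Qed.

Lemma natmx1 : natmx 1.
Proof. by move=> i j; rewrite mxE; case: (i == j); [right|left]. Qed.

Lemma natmx_exp A m : natmx A -> natmx (A ^+ m).
Proof.
move=> nA; elim: m => [|m IH]; first by rewrite expr0; apply: natmx1.
by rewrite exprS; apply: natmx_mul.
Qed.

(** For a [natmx], the relation [A i j != 0] is then transitive ([idem_trans]) and interpolating
    ([idem_interp]), and all positive powers have the same support. *)
Definition idem_support A : Prop := forall i j, ((A * A) i j == 0) = (A i j == 0).

Lemma idem_trans A i j k : natmx A -> idem_support A ->
  A i k != 0 -> A k j != 0 -> A i j != 0.
Proof. by move=> nA iA ik kj; rewrite -iA; apply/natmx_mul_neq0 => //; exists k. Qed.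

Lemma idem_interp A i j : natmx A -> idem_support A ->
  A i j != 0 -> exists2 k, A i k != 0 & A k j != 0.
Proof. by move=> nA iA; rewrite -iA => /natmx_mul_neq0; apply. Qed.

Lemma idem_exp A m i j : natmx A -> idem_support A ->
  ((A ^+ m.+1) i j == 0) = (A i j == 0).
Proof.
move=> nA iA; elim: m i j => [//|m IH] i j; apply: negb_inj; rewrite exprS.
apply/natmx_mul_neq0/idP => //; first exact: natmx_exp.
  by move=> [k ik]; rewrite IH => kj; apply: idem_trans ik kj.
by move=> /(idem_interp nA iA)[k ik kj]; exists k => //; rewrite IH.
Qed.

Lemma rowmul_iter A (z : 'rV[algC]_n.+1) s m j : natmx A -> 0 <= s ->
  (forall j, s * z 0 j <= (z *m A) 0 j) -> s ^+ m * z 0 j <= (z *m A ^+ m) 0 j.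
Proof.
move=> nA s0 h; elim: m j => [|m IH] j; first by rewrite !expr0 mul1r mulmx1.
rewrite exprSr -[A ^+ m.+1]/(A ^+ m.+1) exprSr -mulmxE mulmxA [leRHS]mxE.
rewrite -mulrA; apply: le_trans (_ : s ^+ m * (z *m A) 0 j <= _).
  by rewrite ler_wpM2l// exprn_ge0.
rewrite mxE mulr_sumr; apply: ler_sum => k _.
by rewrite mulrA ler_wpM2r// natmx_ge0.
Qed.

(** Since [lam != 0], each index of the support of [x] has a predecessor in that support. Take [l0]
    with the fewest such predecessors and [l] among them: by transitivity all predecessors of [l0]
    have the same predecessor set, which contains [l]. So [l] is recurrent and its class is entered
    from no other index of the support. *)
Lemma eigen_source A (x : 'rV[algC]_n.+1) lam : natmx A -> idem_support A ->
  x *m A = lam *: x -> x != 0 -> lam != 0 ->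
  exists l, [/\ x 0 l != 0, A l l != 0 &
    forall k, x 0 k != 0 -> A k l != 0 -> A l k != 0].
Proof.
move=> nA iA xA x0 lam0.
pose prec l := [set k | (x 0 k != 0) && (A k l != 0)].
have precP l : x 0 l != 0 -> exists k, k \in prec l.
  move=> xl; have : (x *m A) 0 l != 0 by rewrite xA mxE mulf_neq0.
  move=> /eqP xAl; apply/existsP; apply: contra_notT xAl => /existsPn H.
  rewrite mxE big1// => k _; have := H k; rewrite inE negb_and !negbK.
  by move=> /orP[] /eqP ->; rewrite ?mul0r ?mulr0.
have prec_sub k l : k \in prec l -> prec k \subset prec l.
  rewrite inE => /andP[_ kl]; apply/subsetP => k'; rewrite !inE => /andP[-> k'k].
  exact: idem_trans k'k kl.
have [l1 xl1] : exists l1, x 0 l1 != 0 by apply/rV0Pn.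
have := @arg_minnP _ l1 (fun l => x 0 l != 0) (fun l => #|prec l|) xl1.
case=> l0 xl0 lmin; have [l lP] := precP _ xl0.
have prec_min k : k \in prec l0 -> prec k = prec l0.
  move=> kP; apply/eqP; rewrite eqEcard prec_sub//= lmin//.
  by move: kP; rewrite inE => /andP[].
have pl := prec_min _ lP.
exists l; split.
- by move: lP; rewrite inE => /andP[].
- by move: lP; rewrite -pl inE => /andP[].
move=> k xk kl; have : k \in prec l0 by rewrite -pl inE xk.
by move=> /prec_min pk; move: lP; rewrite -pk inE => /andP[].
Qed.

(** Perron-Frobenius, in the form needed here: the support of [A] being a transitive
relation, the block of [A] on each recurrent class is entrywise positive, so that a
peripheral eigenvector restricted to a source class has constant argument there. *)
Lemma peripheral_root A rho lam : natmx A -> idem_support A -> 0 < rho ->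
  (forall r, root (char_poly A) r -> `|r| <= rho) ->
  root (char_poly A) lam -> `|lam| = rho ->
  lam = rho /\ exists l c, [/\ A l l != 0, 0 < c &
    forall m, c * rho ^+ m <= (A ^+ m.+1) l l].
Proof.
move=> nA iA r0 rmax; rewrite -eigenvalue_root_char => /eigenvalueP[x xA x0] lamrho.
have lam0 : lam != 0 by rewrite -normr_gt0 lamrho.
have [l [xl All src]] := eigen_source nA iA xA x0 lam0.
pose C := [pred k | (x 0 k != 0) && (A k l != 0)].
have lC : l \in C by rewrite inE xl.
have AC k k' : k \in C -> k' \in C -> A k k' != 0.
  rewrite !inE => /andP[_ kl] /andP[xk' k'l]; apply: (idem_trans nA iA kl).
  exact: src.
have Cpred k j : j \in C -> x 0 k != 0 -> A k j != 0 -> k \in C.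
  rewrite !inE => /andP[_ jl] -> kj /=; exact: idem_trans kj jl.
have eig j : j \in C -> lam * x 0 j = \sum_(k in C) x 0 k * A k j.
  move=> jC; have : (x *m A) 0 j = (lam *: x) 0 j by rewrite xA.
  rewrite !mxE => <-; rewrite [RHS]big_mkcond; apply: eq_bigr => k _.
  case: ifPn => // kC; have [->|xk] := eqVneq (x 0 k) 0; first by rewrite mul0r.
  have [->|Akj] := eqVneq (A k j) 0; first by rewrite mulr0.
  by rewrite (Cpred k j jC xk Akj) in kC.
(* [y] is [|x|] restricted to the class [C]. The eigenvalue equation on [C] involves only [C], so
   the triangle inequality gives [rho y <= y A]; the point is that this is an equality on [C]. *)
pose y : 'rV[algC]_n.+1 := \row_k if k \in C then `|x 0 k| else 0.
have yC k : k \in C -> y 0 k = `|x 0 k| by rewrite mxE => ->.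
have yN k : k \notin C -> y 0 k = 0 by rewrite mxE => /negPf ->.
have y0 k : 0 <= y 0 k by rewrite mxE; case: ifP.
have yA0 k : 0 <= (y *m A) 0 k.
  by rewrite mxE sumr_ge0// => i _; rewrite mulr_ge0 ?natmx_ge0.
have yAE j : (y *m A) 0 j = \sum_(k in C) `|x 0 k * A k j|.
  rewrite mxE [RHS]big_mkcond; apply: eq_bigr => k _; case: ifPn => [kC|/yN ->].
    by rewrite yC// normrM (ger0_norm (natmx_ge0 _ _ nA)).
  by rewrite mul0r.
have yA j : rho * y 0 j <= (y *m A) 0 j.
  have [jC|jC] := boolP (j \in C); last by rewrite yN// mulr0.
  by rewrite yC// -lamrho -normrM eig// yAE; apply: ler_norm_sum.
have [rs rsP Aexp] := expoly_mx A.
(* A surplus [w0] at [k0] would spread to the whole class, where the entries of [A] are at least 1.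
   As [z j <= S], the row [z] then satisfies [(rho + w0 / S) z <= z A], and its iterates would
   outgrow what eigenvalues of modulus at most [rho] permit. *)
have tight k0 : k0 \in C -> (y *m A) 0 k0 = rho * y 0 k0.
  move=> k0C; apply/eqP; rewrite eq_le yA andbT; apply/negP => /negP.
  rewrite -real_ltNge ?ger0_real ?mulr_ge0// ?(ltW r0)// => lt0.
  set w0 := (y *m A) 0 k0 - rho * y 0 k0.
  have w0_gt0 : 0 < w0 by rewrite subr_gt0.
  pose z : 'rV[algC]_n.+1 := \row_k if k \in C then (y *m A) 0 k else 0.
  have zC k : k \in C -> z 0 k = (y *m A) 0 k by rewrite mxE => ->.
  have zN k : k \notin C -> z 0 k = 0 by rewrite mxE => /negPf ->.
  have z0 k : 0 <= z 0 k by rewrite mxE; case: ifP.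
  have zk0 : 0 < z 0 k0.
    by rewrite zC//; apply: le_lt_trans lt0; rewrite mulr_ge0// ltW.
  set S := \sum_k z 0 k.
  have zS k : z 0 k <= S by rewrite /S (bigD1 k)//= lerDl sumr_ge0.
  have S0 : 0 < S := lt_le_trans zk0 (zS k0).
  have e0 : 0 < w0 / S by rewrite divr_gt0.
  have re0 : 0 < rho + w0 / S by rewrite addr_gt0.
  have zA j : (rho + w0 / S) * z 0 j <= (z *m A) 0 j.
    have [jC|jC] := boolP (j \in C); last first.
      by rewrite zN// mulr0 mxE sumr_ge0// => k _; rewrite mulr_ge0 ?natmx_ge0.
    rewrite mulrDl; apply: le_trans (_ : rho * (y *m A) 0 j + w0 <= _).
      rewrite {1}zC// lerD2l mulrAC ler_pdivrMr// ler_wpM2l//; exact: ltW.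
    have -> : (z *m A) 0 j = \sum_k z 0 k * A k j by rewrite mxE.
    have -> : (y *m A) 0 j = \sum_k y 0 k * A k j by rewrite mxE.
    rewrite mulr_sumr (bigD1 k0)//= [leRHS](bigD1 k0)//=.
    rewrite addrAC; apply: lerD.
      rewrite zC// -[(y *m A) 0 k0](subrK (rho * y 0 k0)) -/w0 mulrDl addrC mulrA.
      by rewrite lerD2r ler_peMr ?(ltW w0_gt0)// natmx_ge1// AC.
    apply: ler_sum => k _; rewrite mulrA ler_wpM2r ?natmx_ge0//.
    by have [kC|kC] := boolP (k \in C); [rewrite zC|rewrite zN// yN// mulr0].
  have fE : expoly rs (fun m => (z *m A ^+ m) 0 k0).
    have H k := expoly_scale (z 0 k) (Aexp k k0).
    by apply: expoly_ext (expoly_sum H) => m; rewrite mxE.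
  have /(_ (rho + w0 / S))[|N HN] := expoly_small fE _ zk0.
    by move=> r; rewrite rsP => /rmax h; apply: le_lt_trans h _; rewrite ltrDl.
  have := HN N (leqnn N); rewrite subr0 normrM normfV.
  have h := rowmul_iter N k0 nA (ltW re0) zA.
  rewrite (ger0_norm (exprn_ge0 _ (ltW re0))) ger0_norm; last first.
    by apply: le_trans h; rewrite mulr_ge0 ?exprn_ge0// ltW.
  by rewrite ltr_pdivrMr ?exprn_gt0// mulrC => /(le_lt_trans h); rewrite ltxx.
have yl0 : 0 < y 0 l by rewrite yC// normr_gt0.
split.
  (* Equality in the triangle inequality: all terms have a common argument [t]. The term of index
     [l] gives [x 0 l = |x 0 l| t], the sum gives [lam * x 0 l = rho * |x 0 l| * t]. *)
  have /normC_sum_eq[t _ tP] :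
      `|\sum_(k in C) x 0 k * A k l| = \sum_(k in C) `|x 0 k * A k l|.
    by rewrite -eig// normrM lamrho -yC// -tight// yAE.
  have xt : x 0 l = `|x 0 l| * t.
    have := tP l lC; rewrite normrM (ger0_norm (natmx_ge0 _ _ nA)) -mulrA [A l l * t]mulrC.
    by rewrite mulrA => /(mulIf All).
  apply: (mulIf xl); rewrite eig// (eq_bigr _ tP) -mulr_suml -yAE tight// yC//.
  by rewrite -mulrA -xt.
set S := \sum_k y 0 k.
have yS k : y 0 k <= S by rewrite /S (bigD1 k)//= lerDl sumr_ge0.
have S0 : 0 < S := lt_le_trans yl0 (yS l).
(* From [rho ^+ m * y 0 l <= (y *m A ^+ m) 0 l], with each [y 0 k <= S]; one extra factor
   [A l k >= 1] closes the paths from [k] to [l] into loops at [l], hence the exponent [m.+1]. *)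
exists l, (y 0 l / S); split=> //; first by rewrite divr_gt0.
move=> m; rewrite mulrAC ler_pdivrMr// mulrC.
apply: le_trans (rowmul_iter m l nA (ltW r0) yA) _.
rewrite mxE exprS mxmulE mulr_suml; apply: ler_sum => k _.
rewrite mulrAC ler_wpM2r ?natmx_ge0//; first exact: natmx_exp.
have [kC|kC] := boolP (k \in C); last by rewrite yN// mulr_ge0 ?natmx_ge0// ltW.
by apply: le_trans (yS k) _; rewrite ler_peMl ?(ltW S0)// natmx_ge1// AC.
Qed.

(** The restriction of [A] to the indices met on the way from [i] to [j]. Its spectral radius is the
    growth rate of the [(i, j)] entry, whereas that of [A] may come from classes not met on the
    way. *)
Definition between A i j : 'M[algC]_n.+1 :=
  \matrix_(k, l) if [&& A i k != 0, A k j != 0, A i l != 0 & A l j != 0] then A k l else 0.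

Lemma between_neq0 A i j k l : (between A i j k l != 0) =
  [&& A k l != 0, A i k != 0, A k j != 0, A i l != 0 & A l j != 0].
Proof. by rewrite mxE; case: ifPn; rewrite ?andbT ?andbF ?eqxx. Qed.

Lemma betweenE A i j k l : between A i j k l != 0 -> between A i j k l = A k l.
Proof. by rewrite mxE; case: ifP => //; rewrite eqxx. Qed.

Lemma natmx_between A i j : natmx A -> natmx (between A i j).
Proof. by move=> nA k l; rewrite mxE; case: ifP => _; [apply: nA|left]. Qed.

Lemma idem_between A i j : natmx A -> idem_support A -> idem_support (between A i j).
Proof.
move=> nA iA k l; apply: negb_inj; have nB := natmx_between i j nA.
apply/natmx_mul_neq0/idP => //.
  move=> [p]; rewrite !between_neq0 => /and5P[kp ik kj ip pj] /and5P[pl _ _ il lj].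
  by rewrite ik kj il lj (idem_trans nA iA kp pl).
rewrite between_neq0 => /and5P[kl ik kj il lj].
have [p kp pl] := idem_interp nA iA kl.
have ip := idem_trans nA iA ik kp; have pj := idem_trans nA iA pl lj.
by exists p; rewrite between_neq0 ?kp ?pl ?ik ?kj ?ip ?pj ?il ?lj.
Qed.

(** By transitivity, every vertex after the first of a path from [i] to [l] lies between [i] and
    [j]. The vertex [i] itself need not, so the first step keeps the factor [A]. *)
Lemma between_exp A i j m l : natmx A -> idem_support A -> A l j != 0 ->
  (A ^+ m.+1) i l = (A * between A i j ^+ m) i l.
Proof.
move=> nA iA; elim: m l => [|m IH] l lj; first by rewrite expr1 expr0 mulr1.
rewrite [between A i j ^+ _]exprSr mulrA [RHS]mxmulE exprSr mxmulE; apply: eq_bigr => k _.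
have [b0|bn0] := eqVneq (between A i j k l) 0.
  rewrite b0 mulr0; apply/eqP; apply: contraTT isT; rewrite mulf_eq0 negb_or.
  rewrite idem_exp// => /andP[ik kl]; have := between_neq0 A i j k l.
  rewrite b0 eqxx kl ik lj (idem_trans nA iA kl lj) (idem_trans nA iA ik kl).
  by [].
rewrite (betweenE bn0) IH//.
by move: bn0; rewrite between_neq0 => /and5P[].
Qed.

(** With [B] the matrix between [i] and [j], [(A ^+ m.+2) i j] is the sum of
    [A i k * (B ^+ m) k l * A l j]. It is at least 1, so the spectral radius of [B] is at least 1;
    [peripheral_root] makes it the only peripheral eigenvalue and supplies the lower bound required
    by [expoly_asy]. *)
Lemma power_asy A i j : natmx A -> idem_support A -> A i j != 0 ->
  exists rho d c, asy (fun m => (A ^+ m) i j) rho d c.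
Proof.
move=> nA iA Aij; set B := between A i j.
have nB : natmx B := natmx_between i j nA.
have iB : idem_support B := idem_between i j nA iA.
pose f m := \sum_k \sum_l A i k * A l j * (B ^+ m) k l.
have fA m : f m = (A ^+ m.+2) i j.
  rewrite exprSr mxmulE /f exchange_big; apply: eq_bigr => l _ /=.
  have [->|lj] := eqVneq (A l j) 0.
    by rewrite mulr0 big1// => k _; rewrite mulr0 mul0r.
  rewrite (between_exp i m nA iA lj) mxmulE mulr_suml; apply: eq_bigr => k _.
  by rewrite mulrAC.
have [rs rsP Bexp] := expoly_mx B.
have fE : expoly rs f.
  by apply: expoly_sum => k; apply: expoly_sum => l; apply: expoly_scale.
have f1 m : 1 <= f m.
  by rewrite fA; apply: natmx_ge1; [apply: natmx_exp|rewrite idem_exp].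
have [r0 r0rs r0_1] : exists2 r, r \in rs & ~~ (`|r| < 1).
  apply/hasP; apply: contraT; rewrite -all_predC => /allP H.
  have /(_ 1)[|N HN] := expoly_small fE _ ltr01.
    by move=> r /H; rewrite /= negbK.
  have := HN N (leqnn N); rewrite expr1n divr1 subr0 ger0_norm.
    by move=> /(le_lt_trans (f1 N)); rewrite ltxx.
  exact: le_trans ler01 (f1 N).
have [lam lamrs lamP] : exists2 lam, lam \in rs & forall r, r \in rs -> `|r| <= `|lam|.
  exact: max_norm_seq r0rs.
have rho1 : 1 <= `|lam|.
  by apply: le_trans (lamP _ r0rs); rewrite real_leNgt ?real1 ?normr_real.
have rho0 : 0 < `|lam| := lt_le_trans ltr01 rho1.
have Brmax r : root (char_poly B) r -> `|r| <= `|lam| by rewrite -rsP => /lamP.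
have Blam : root (char_poly B) lam by rewrite -rsP.
have [_ [l [c [Bll c0 cP]]]] := peripheral_root nB iB rho0 Brmax Blam erefl.
have rsdom r : r \in rs -> r = `|lam| \/ `|r| < `|lam|.
  move=> rrs; have := lamP r rrs; rewrite le_eqVlt => /orP[/eqP rE|]; last by right.
  by left; have [] := peripheral_root nB iB rho0 Brmax (etrans (esym (rsP r)) rrs) rE.
have fge m : (1 <= m)%N -> c / `|lam| * `|lam| ^+ m <= f m.
  case: m => // m _; rewrite exprS mulrA divfK ?lt0r_neq0//.
  apply: le_trans (cP m) _; rewrite /f (bigD1 l)//= (bigD1 l)//= -addrA.
  move: Bll; rewrite between_neq0 => /and5P[_ il lj _ _].
  apply: le_trans (_ : A i l * A l j * (B ^+ m.+1) l l <= _).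
    by rewrite ler_peMl ?natmx_ge0 ?mulr_ege1 ?natmx_ge1//; apply: natmx_exp.
  rewrite lerDl addr_ge0// ?sumr_ge0// => k _; rewrite ?sumr_ge0// => *;
    by rewrite !mulr_ge0 ?natmx_ge0//; apply: natmx_exp.
have [d [k [_ k0 kP]]] := expoly_asy fE rho0 rsdom (divr_gt0 c0 rho0) fge.
exists `|lam|, d, (k / `|lam| / `|lam|); do 2 apply: asy_unshift.
by apply: (asy_ext (N := 0)) (And3 rho0 k0 kP) => m _; rewrite fA.
Qed.
End NonnegativeMatrices.

(** * Idempotent powers and bilinear forms in them *)

Section IdempotentPower.
Variable n : nat.
Implicit Types A B : 'M[algC]_n.+1.

Definition mxsupp A := [set p : 'I_n.+1 * 'I_n.+1 | A p.1 p.2 != 0].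

Lemma mxsupp_mul A A' B B' : natmx A -> natmx A' -> natmx B -> natmx B' ->
  mxsupp A = mxsupp A' -> mxsupp B = mxsupp B' -> mxsupp (A * B) = mxsupp (A' * B').
Proof.
move=> nA nA' nB nB' /setP sA /setP sB; apply/setP => -[i j]; rewrite !inE /=.
have sA' k : (A i k != 0) = (A' i k != 0) by have := sA (i, k); rewrite !inE.
have sB' k : (B k j != 0) = (B' k j != 0) by have := sB (k, j); rewrite !inE.
apply/natmx_mul_neq0/natmx_mul_neq0 => // -[k];
  by [rewrite sA' sB'; exists k | rewrite -sA' -sB'; exists k].
Qed.

Lemma idem_power A : natmx A -> exists2 q, (0 < q)%N & idem_support (A ^+ q).
Proof.
move=> nA; set K := #|{: {set 'I_n.+1 * 'I_n.+1}}|.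
pose F (i : 'I_K.+1) := mxsupp (A ^+ i).
have /injectivePn[i0 [j0 ij0 Fij0]] : ~~ injectiveb F.
  by apply/injectiveP => /leq_card; rewrite card_ord ltnn.
have [i [j [ij Fij]]] : exists i j, (i < j)%N /\ mxsupp (A ^+ i) = mxsupp (A ^+ j).
  move: ij0; rewrite -val_eqE neq_ltn => /orP[] h.
    by exists i0, j0.
  by exists j0, i0; split => //; symmetry.
have per k : mxsupp (A ^+ (i + k)) = mxsupp (A ^+ (i + k + (j - i))).
  have -> : (i + k + (j - i) = j + k)%N by lia.
  by rewrite !exprD; apply: mxsupp_mul => //; apply: natmx_exp.
have perM k l : mxsupp (A ^+ (i + k)) = mxsupp (A ^+ (i + k + l * (j - i))).
  elim: l => [|l ->]; first by rewrite mul0n addn0.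
  by rewrite -addnA per; congr (mxsupp (A ^+ _)); rewrite mulSn addnA; lia.
have ji : (0 < j - i)%N by rewrite subn_gt0.
(* The supports of the powers are periodic of period [j - i] from [i] on. A positive multiple [q] of
   the period with [i <= q] gives equal supports at [q] and [2 q]. *)
exists (i.+1 * (j - i))%N; first by rewrite muln_gt0.
set q := (i.+1 * (j - i))%N.
have iq : (i <= q)%N by apply: leq_trans (leqnSn i) _; apply: leq_pmulr.
have := perM (q - i)%N i.+1; rewrite subnKC// -/q exprD => /setP S k l.
by have := S (k, l); rewrite !inE => /negb_inj ->.
Qed.

Lemma bilinear_regular A (x : 'rV[algC]_n.+1) (y : 'cV[algC]_n.+1) :
  natmx A -> idem_support A -> (forall i, 0 <= x 0 i) -> (forall i, 0 <= y i 0) ->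
  regular (fun m => (x *m A ^+ m *m y) 0 0).
Proof.
move=> nA iA x0 y0.
have H : regular (fun m => \sum_j \sum_i x 0 i * y j 0 * (A ^+ m) i j).
  apply: regular_sum => j; apply: regular_sum => i; apply: regularZ; first exact: mulr_ge0.
  have [Aij|Aij] := eqVneq (A i j) 0; last by right; apply: power_asy.
  by left; exists 1%N; case=> // m _; apply/eqP; rewrite idem_exp// Aij.
apply: (regular_ext (N := 0)) H => m _; rewrite mxE; apply: eq_bigr => j _.
by rewrite mxE mulr_suml; apply: eq_bigr => i _; rewrite mulrAC.
Qed.

(** With nonnegative terms, vanishing depends only on supports, and the positive powers share
    theirs; [A ^+ 0] has the diagonal one, so the exponent starts at 1. *)
Lemma bilinear_eq0 A (x : 'rV[algC]_n.+1) (y : 'cV[algC]_n.+1) m :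
  natmx A -> idem_support A -> (forall i, 0 <= x 0 i) -> (forall i, 0 <= y i 0) ->
  ((x *m A ^+ m.+1 *m y) 0 0 == 0) = ((x *m A *m y) 0 0 == 0).
Proof.
move=> nA iA x0 y0.
have E B : natmx B -> ((x *m B *m y) 0 0 == 0) =
    [forall j, forall i, [|| x 0 i == 0, B i j == 0 | y j 0 == 0]].
  move=> nB; rewrite mxE psumr_eq0; last first.
    by move=> j _; rewrite mulr_ge0// mxE sumr_ge0// => i _; rewrite mulr_ge0 ?natmx_ge0.
  apply/allP/'forall_forallP => H j.
    move=> i; have := H j (mem_index_enum _); rewrite /= mulf_eq0 orbA.
    case: (y j 0 == 0); rewrite ?orbT// orbF mxE orbF psumr_eq0; last first.
      by move=> k _; rewrite mulr_ge0 ?natmx_ge0.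
    by move=> /allP/(_ i (mem_index_enum _)); rewrite /= mulf_eq0.
  move=> _ /=; rewrite mulf_eq0; have [//|yj] := eqVneq (y j 0) 0; first by rewrite orbT.
  rewrite orbF mxE big1// => i _; have := H j i; rewrite (negPf yj) orbF.
  by move=> /orP[] /eqP ->; rewrite ?mul0r ?mulr0.
rewrite !E//; last exact: natmx_exp.
by apply: eq_forallb => j; apply: eq_forallb => i; rewrite idem_exp.
Qed.

End IdempotentPower.

(** * Incidence matrices of morphisms *)

Section Incidence.
Variables (T : Type) (g : T -> seq T) (n : nat) (rank : T -> 'I_n.+1) (unrank : 'I_n.+1 -> T).
Hypothesis rankK : cancel rank unrank.

Definition parikh (u : seq T) : 'rV[algC]_n.+1 :=
  \row_i (count (fun c => rank c == i) u)%:R.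

Definition incidence : 'M[algC]_n.+1 := \matrix_i parikh (g (unrank i)).

Lemma parikh_cat u1 u2 : parikh (u1 ++ u2) = parikh u1 + parikh u2.
Proof. by apply/rowP => i; rewrite !mxE count_cat natrD. Qed.

Lemma parikh_cons c u : parikh (c :: u) = delta_mx 0 (rank c) + parikh u.
Proof. by apply/rowP => i; rewrite !mxE /= natrD eq_sym. Qed.

Lemma parikh_apply u : parikh (flat_map g u) = parikh u *m incidence.
Proof.
elim: u => [|c u IH] /=.
  have -> : parikh [::] = 0 by apply/rowP => i; rewrite !mxE.
  by rewrite mul0mx.
rewrite parikh_cat IH parikh_cons mulmxDl -rowE rowK rankK.
by [].
Qed.

Lemma parikh_weight v u :
  (weight v u)%:R = (parikh u *m \col_i (v (unrank i))%:R) 0 0.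
Proof.
elim: u => [|c u IH].
  by rewrite mxE big1// => i _; rewrite mxE mul0r.
rewrite parikh_cons mulmxDl mxE -IH -rowE !mxE rankK.
by rewrite -natrD.
Qed.

Lemma parikh_iter v m u : (weight v (morph_iter g m u))%:R =
  (parikh u *m incidence ^+ m *m \col_i (v (unrank i))%:R) 0 0.
Proof.
elim: m u => [|m IH] u; first by rewrite expr0 mulmx1 -parikh_weight.
by rewrite morph_iter_succ IH parikh_apply exprS -mulmxE !mulmxA.
Qed.

Lemma natmx_incidence : natmx incidence.
Proof.
move=> i j; rewrite !mxE; case: (count _ _) => [|k]; first by left.
by right; rewrite ler1n.
Qed.

End Incidence.

(** Equality on [T] need not be decidable, so [rank] chooses an index for each letter. Repetitions
    in the list leave indices that are the rank of no letter, hence only a one-sided inverse. The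
    letter [a] makes the index set nonempty. *)
Lemma finite_rank (T : Type) (a : T) : finite_type T ->
  exists n (rank : T -> 'I_n.+1) (unrank : 'I_n.+1 -> T), cancel rank unrank.
Proof.
move=> [l lP]; pose s := a :: l; exists (size l); pose unrank (i : 'I_(size l).+1) := nth a s i.
have H c : exists i, unrank i = c.
  suff [i il <-] : exists2 i, (i < size s)%N & nth a s i = c.
    by exists (Ordinal il).
  have : In c s by right; apply: lP.
  elim: (s) => //= x s' IH [->|/IH[i il <-]]; first by exists 0%N.
  by exists i.+1.
pose rank c := proj1_sig (constructive_indefinite_description _ (H c)).
by exists rank, unrank => c; rewrite /rank; case: constructive_indefinite_description.
Qed.

(** The quotient [f (m + 1) / f m] tends to [rho], and the cases are [rho <= 1] and [rho > 1]. The
    bounds [1 + 1 / t] are cleared of denominators, which leaves a statement about natural numbers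
    alone. *)
Lemma ratio_dichotomy (f : nat -> nat) : regular (fun m => (f m)%:R) -> (forall m, (0 < f m)%N) ->
  (forall t, exists N, forall m, (N <= m)%N -> (t * f m.+1 <= t.+1 * f m)%N) \/
  (exists2 t, (0 < t)%N & exists N, forall m, (N <= m)%N -> (t.+1 * f m <= t * f m.+1)%N).
Proof.
move=> freg f0; have fR m : 0 < (f m)%:R :> algC by rewrite ltr0n.
case: freg => [[N /(_ N (leqnn N))/eqP]|[rho [d [c fA]]]].
  by rewrite pnatr_eq0 -leqn0 leqNgt f0.
have [r0 c0 _] := fA; have fr := asy_ratioS fA.
have fmR m : (f m.+1)%:R / (f m)%:R - rho \is Num.real.
  by rewrite rpredB ?ger0_real ?divr_ge0 ?ler0n ?(ltW r0).
have [r1|r1] := real_leP (gtr0_real r0) (real1 _).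
  left=> -[|t]; first by exists 0%N => m _; rewrite mul0n.
  have t0 : 0 < t.+1%:R :> algC by rewrite ltr0n.
  have /fr[N HN] : 0 < t.+1%:R^-1 :> algC by rewrite invr_gt0.
  exists N => m /HN; rewrite real_ltr_distl// => /andP[_ h].
  rewrite -(ler_nat algC) !natrM; have : (f m.+1)%:R / (f m)%:R <= 1 + t.+1%:R^-1 :> algC.
    by apply: le_trans (ltW h) _; rewrite lerD2r.
  rewrite ler_pdivrMr// -(ler_pM2l t0) mulrA mulrDr mulr1 divff ?lt0r_neq0//.
  by rewrite [t.+2%:R]mulrS addrC.
right; have e0 : 0 < (rho - 1) / 2%:R by rewrite divr_gt0 ?ltr0n// subr_gt0.
have [M HM] := tends_invn e0; have [N HN] := fr _ e0.
exists M.+1 => //; exists N => m /HN; rewrite real_ltr_distl// => /andP[h _].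
have {HM} := HM M (leqnn M); rewrite subr0 normfV normr_nat => hM.
have t0 : 0 < M.+1%:R :> algC by rewrite ltr0n.
rewrite -(ler_nat algC) !natrM; have : 1 + M.+1%:R^-1 <= (f m.+1)%:R / (f m)%:R :> algC.
  apply: le_trans (ltW h); apply: le_trans (_ : 1 + (rho - 1) / 2%:R <= _).
    by rewrite lerD2l ltW.
  by rewrite (_ : rho - (rho - 1) / 2%:R = 1 + (rho - 1) / 2%:R)//; field.
rewrite ler_pdivlMr// -(ler_pM2l t0) mulrA mulrDr mulr1 divff ?lt0r_neq0//.
by rewrite [M.+2%:R]mulrS addrC.
Qed.

(** The exponent depends on the support of the incidence matrix only, so one [q] serves all [v]. It
    is applied to the indicator of the letters outside [Delta] and to the constant 1, which measures
    length. *)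
Theorem stable_power (T : Type) (h : T -> list T) (a : T) : finite_type T ->
  exists q, (0 < q)%coq_nat /\ forall v : T -> nat,
    (forall u m, weight v (morph_iter h (q * S m)%coq_nat u) = 0%N <->
                 weight v (morph_iter h q u) = 0%N) /\
    forall u, (forall m, weight v (morph_iter h (q * m)%coq_nat u) <> 0%N) ->
    (forall t, exists N, forall m, (N <= m)%coq_nat ->
       (t * weight v (morph_iter h (q * S m) u)
        <= S t * weight v (morph_iter h (q * m) u))%coq_nat) \/
    (exists t, (0 < t)%coq_nat /\ exists N, forall m, (N <= m)%coq_nat ->
       (S t * weight v (morph_iter h (q * m) u)
        <= t * weight v (morph_iter h (q * S m) u))%coq_nat).
Proof.
move=> /(finite_rank a)[n [rank [unrank rankK]]].
set A := incidence h rank unrank; have nA : natmx A := natmx_incidence _ _ _.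
have [q q0 iA] := idem_power nA; exists q; split; first exact/ssrnat.ltP.
have nAq := natmx_exp q nA.
have x0 u i : 0 <= parikh rank u 0 i by rewrite mxE.
move=> v; pose y : 'cV[algC]_n.+1 := \col_i (v (unrank i))%:R.
have y0 i : 0 <= y i 0 by rewrite mxE.
have VE u m : (weight v (morph_iter h (q * m) u))%:R = (parikh rank u *m (A ^+ q) ^+ m *m y) 0 0.
  by rewrite -exprM; apply: parikh_iter.
split=> [u m|u u0].
  have E k : (weight v (morph_iter h (q * k) u) = 0%N) <->
      (parikh rank u *m (A ^+ q) ^+ k *m y) 0 0 == 0.
    by rewrite -VE pnatr_eq0; split => [->|/eqP].
  have E1 := E 1%N; rewrite muln1 expr1 in E1.
  split=> [/(proj1 (E m.+1))|/(proj1 E1) h0]; first by rewrite bilinear_eq0// => /(proj2 E1).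
  by apply: (proj2 (E m.+1)); rewrite bilinear_eq0.
have /ratio_dichotomy H : regular (fun m => (weight v (morph_iter h (q * m) u))%:R).
  by apply: (regular_ext (N := 0)) (bilinear_regular nAq iA (x0 u) y0) => m _; rewrite VE.
have {H} [m|H|[t t0 [N HN]]] := H.
- by rewrite lt0n; apply/eqP; apply: u0.
- by left=> t; have [N HN] := H t; exists N => m /ssrnat.leP/HN/ssrnat.leP.
right; exists t; split; first exact/ssrnat.ltP.
by exists N => m /ssrnat.leP/HN/ssrnat.leP.
Qed.

(** * Accumulation points of ratios of weights *)

Lemma tends_horner (P : {poly algC}) f c : tends f c -> tends (fun m => P.[f m]) P.[c].
Proof.
move=> fc; elim/poly_ind: P => [|P r IH].
  by apply: (tends_ext (N := 0)) (tends_cst _) => m _; rewrite !horner0.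
rewrite hornerMXaddC; apply: (tends_ext (N := 0)) (tendsD (tendsM IH fc) (tends_cst r)) => m _.
by rewrite hornerMXaddC.
Qed.

Lemma algC_ratpoly_root (c : algC) : exists2 P : {poly rat}, P != 0 & (map_poly ratr P).[c] = 0.
Proof.
have [P [PE Pmon] _] := minCpolyP c; exists P; first exact: monic_neq0.
by rewrite -PE; apply/rootP/root_minCpoly.
Qed.

(** On the class of [s] modulo [q] the weights are bilinear forms in [(A ^+ q) ^+ m], hence regular,
    and their ratio converges to an algebraic number. [P] is the product of one rational polynomial
    for each of the [q] limits. *)
Lemma ratio_ratpoly (T : Type) (g : T -> list T) (v : T -> nat) (al be : list T) (C : nat) :
  finite_type T ->
  (forall m, weight v (morph_iter g m be) <> 0%N) ->
  (forall m, weight v (morph_iter g m al) <= C * weight v (morph_iter g m be))%N ->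
  exists2 P : {poly rat}, P != 0 &
    tends (fun m => (map_poly ratr P).[(weight v (morph_iter g m al))%:R /
                                       (weight v (morph_iter g m be))%:R]) 0.
Proof.
move=> fT be0 albe; have a : T.
  by case: be be0 {albe} => [/(_ 0%N)|].
have [n [rank [unrank rankK]]] := finite_rank a fT.
set A := incidence g rank unrank; have nA : natmx A := natmx_incidence _ _ _.
have [q q0 iA] := idem_power nA; have nAq := natmx_exp q nA.
set X := fun m => weight v (morph_iter g m al); set Y := fun m => weight v (morph_iter g m be).
have reg s u : regular (fun m => (weight v (morph_iter g (s + q * m) u))%:R).
  have H := @bilinear_regular _ (A ^+ q) (parikh rank u *m A ^+ s) (\col_i (v (unrank i))%:R) nAq iA.
  apply: (regular_ext (N := 0)) (H _ _) => [m _|i|i]; last by rewrite mxE.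
    by rewrite (parikh_iter g rankK) exprD -mulmxE exprM mulmxA.
  rewrite mxE sumr_ge0// => k _; rewrite mulr_ge0 ?natmx_ge0// ?mxE//.
  exact: natmx_exp.
have lim s : exists c, tends (fun m => (X (s + q * m)%N)%:R / (Y (s + q * m)%N)%:R) c.
  apply: (regular_ratio (C := C%:R) (reg s al) (reg s be)) => m.
    by rewrite ltr0n lt0n; apply/eqP.
  by rewrite normr_nat -natrM ler_nat.
have [P P0 HP] : exists2 P : {poly rat}, P != 0 & forall s, (s < q)%N ->
    tends (fun m => (map_poly ratr P).[(X (s + q * m)%N)%:R / (Y (s + q * m)%N)%:R]) 0.
  suff [P P0 HP] : exists2 P : {poly rat}, P != 0 & forall s, (s < q)%N -> exists2 c,
      tends (fun m => (X (s + q * m)%N)%:R / (Y (s + q * m)%N)%:R) c & (map_poly ratr P).[c] = 0.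
    by exists P => // s /HP[c cP <-]; apply: tends_horner.
  elim: {1}q => [|k [P P0 IH]]; first by exists 1; rewrite ?oner_neq0.
  have [c cP] := lim k; have [Q Q0 Qc] := algC_ratpoly_root c.
  exists (P * Q) => [|s]; first by rewrite mulf_neq0.
  rewrite ltnS leq_eqVlt => /orP[/eqP ->|/IH[d dP Pd]].
    by exists c => //; rewrite rmorphM hornerM Qc mulr0.
  by exists d => //; rewrite rmorphM hornerM Pd mul0r.
exists P => // e e0.
have [N HN] : exists N, forall s m, (s < q)%N -> (N <= m)%N ->
    `|(map_poly ratr P).[(X (s + q * m)%N)%:R / (Y (s + q * m)%N)%:R] - 0| < e.
  suff H k : (k <= q)%N -> exists N, forall s m, (s < k)%N -> (N <= m)%N ->
      `|(map_poly ratr P).[(X (s + q * m)%N)%:R / (Y (s + q * m)%N)%:R] - 0| < e.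
    exact: H.
  elim: k => [|k IH] kq; first by exists 0%N.
  have [M HM] := HP k kq e e0; have [N HN] := IH (ltnW kq); exists (maxn N M) => s m.
  rewrite geq_max ltnS leq_eqVlt => /orP[/eqP ->|sk] /andP[Nm Mm]; first exact: HM.
  exact: HN.
exists (q * N)%N => m Nm; rewrite [m](divn_eq m q) addnC mulnC.
by apply: HN; [apply: ltn_pmod|rewrite leq_divRL// mulnC].
Qed.

Lemma IZR_Z_of_int c : IZR (Z_of_int c) = c%:~R.
Proof.
case: c => n; first by rewrite /= -INR_IZR_INZ INRE.
have -> : Z_of_int (Negz n) = Z.opp (Z.of_nat n.+1) by rewrite /=; lia.
by rewrite opp_IZR -INR_IZR_INZ INRE RoppE NegzE mulrNz.
Qed.

Lemma zpoly_eval_map (s : seq int) (x : R) :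
  zpoly_eval (List.map Z_of_int s) x = \sum_(i < size s) (s`_i)%:~R * x ^+ i.
Proof.
elim: s => [|c s IH] /=; first by rewrite big_ord0.
rewrite /zpoly_eval /= in IH *; rewrite IH big_ord_recl /= expr0 mulr1.
rewrite RplusE RmultE IZR_Z_of_int mulr_sumr; congr (_ + _); apply: eq_bigr => i _.
by rewrite exprS mulrCA.
Qed.

(** The values of the polynomial at the ratios are rational, so their convergence to 0 passes from
    [algC] to [rat] and from there to [R]; clearing denominators makes the coefficients integers. *)
Theorem ratio_accumulation (T : Type) (g : T -> list T) (v : T -> nat) (al be : list T) (C : nat) :
  finite_type T ->
  (forall m, weight v (morph_iter g m be) <> 0%N) ->
  (forall m, (weight v (morph_iter g m al) <= C * weight v (morph_iter g m be))%coq_nat) ->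
  exists p : list Z, (exists c, In c p /\ c <> Z0) /\
    forall eps : R, Rlt (IZR Z0) eps -> exists N, forall m, (N <= m)%coq_nat ->
      Rlt (Rabs (zpoly_eval p (Rdiv (INR (weight v (morph_iter g m al)))
                                    (INR (weight v (morph_iter g m be)))))) eps.
Proof.
move=> fT be0 albe.
have [m|P P0 HP] := ratio_ratpoly fT be0 (C := C) (al := al); first exact/ssrnat.leP.
have [Q [a a0 PQ]] := rat_poly_scale P.
have Q0 : Q != 0.
  by apply: contra_neq P0 => Q0; rewrite PQ Q0 rmorph0 scaler0.
exists (List.map Z_of_int Q); split.
  exists (Z_of_int (lead_coef Q)); split.
    rewrite lead_coefE; set k := (size Q).-1.
    have : (k < size Q)%N by rewrite /k prednK// lt0n size_poly_eq0.
    elim: (polyseq Q) k => // c s IH [|k] ks; first by left.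
    by right; apply: IH.
  by move=> /(congr1 IZR); rewrite IZR_Z_of_int => /eqP; rewrite intr_eq0 lead_coef_eq0 (negPf Q0).
move=> eps /RltP eps0.
have [k k0 keps] : exists2 k, (0 < k)%N & k%:R^-1 < eps.
  exists (Num.Def.archi_bound eps^-1).+1 => //.
  rewrite invf_plt ?posrE// ?ltr0n//; apply: lt_trans (archi_boundP _) _.
    by rewrite invr_ge0 ltW.
  by rewrite ltr_nat.
have a1 : 0 < `|a%:~R : rat| by rewrite normr_gt0 intr_eq0.
(* The tolerance must be rational to be compared in both fields; the factor [|a|] compensates the
   scaling from [P] to the integral polynomial [Q]. *)
have /HP[N HN] : 0 < ratr (k%:R^-1 / `|a%:~R|) :> algC by rewrite ltr0q divr_gt0 ?invr_gt0 ?ltr0n.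
exists N => m /ssrnat.leP /HN; set X := weight _ _; set Y := weight _ _.
rewrite subr0.
have -> : X%:R / Y%:R = ratr (X%:R / Y%:R) :> algC by rewrite fmorph_div !rmorph_nat.
rewrite horner_map /= -ratr_norm ltr_rat PQ hornerZ normrM normfV ltr_pdivlMr// mulrAC mulVf ?lt0r_neq0// mul1r.
rewrite -(ltr_rat R) ratr_norm -horner_map /= => H.
apply/RltP; apply: le_lt_trans keps; apply: ltW; move: H.
rewrite fmorphV rmorph_nat fmorph_div !rmorph_nat => H.
have PE : map_poly ratr (map_poly intr Q) = map_poly intr Q :> {poly R}.
  by apply/polyP => i; rewrite !coef_map /= ratr_int.
rewrite PE (horner_coef_wide (n := size Q)) ?size_poly// in H.
rewrite zpoly_eval_map RabsE RdivE !INRE; apply: le_lt_trans H; rewrite le_eqVlt; apply/orP; left.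
by apply/eqP; congr (`| _ |); apply: eq_bigr => i _; rewrite coef_map.
Qed.

End MatrixGrowth.

Import ListNotations.

(** * Gaps between consecutive marked letters *)

Section Markers.
Context {T : Type}.
Variable D : T -> bool.

Definition marked (u : list T) : bool := existsb (fun d => negb (D d)) u.

(** Without a letter outside [D], [first_mark u] is [length u] and [last_mark u] is [0];
otherwise [last_mark u] is one more than the position of the last such letter. *)
Fixpoint first_mark (u : list T) : nat :=
  match u with
  | [] => 0
  | c :: u' => if D c then S (first_mark u') else 0
  end.

Fixpoint last_mark (u : list T) : nat :=
  match u with
  | [] => 0
  | c :: u' => if marked u' then S (last_mark u') else if D c then 0 else 1
  end.

Lemma marked_app u1 u2 : marked (u1 ++ u2) = orb (marked u1) (marked u2).
Proof. apply existsb_app. Qed.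

Lemma markedP u d : marked u = true <->
  exists t, (t < length u)%nat /\ D (nth t u d) = false.
Proof.
  unfold marked; rewrite existsb_exists; split.
  - intros [c [Hc Dc]]; destruct (In_nth _ _ d Hc) as [t [Ht <-]].
    exists t; split; [assumption|now destruct (D _)].
  - intros [t [Ht Dt]]; exists (nth t u d); split; [now apply nth_In|now rewrite Dt].
Qed.

Lemma first_mark_app u1 u2 : first_mark (u1 ++ u2) =
  if marked u1 then first_mark u1 else (length u1 + first_mark u2)%nat.
Proof.
  induction u1 as [|c u1 IH]; simpl; [reflexivity|].
  destruct (D c); simpl; [|reflexivity].
  rewrite IH; now destruct (marked u1).
Qed.

Lemma last_mark_app u1 u2 : last_mark (u1 ++ u2) =
  if marked u2 then (length u1 + last_mark u2)%nat else last_mark u1.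
Proof.
  induction u1 as [|c u1 IH]; simpl.
  - destruct (marked u2) eqn:E; [reflexivity|].
    destruct u2 as [|d u2]; [reflexivity|]; simpl in *.
    apply orb_false_iff in E; destruct E as [Dd ->]; now destruct (D d).
  - rewrite marked_app, IH; destruct (marked u2); simpl.
    + now rewrite orb_true_r.
    + now rewrite orb_false_r.
Qed.

Lemma first_mark_eq u d t : (t < length u)%nat -> D (nth t u d) = false ->
  (forall s, (s < t)%nat -> D (nth s u d) = true) -> first_mark u = t.
Proof.
  revert t; induction u as [|c u IH]; simpl; intros t Ht Dt H; [lia|].
  destruct t as [|t]; [now rewrite Dt|].
  rewrite (H 0%nat) by lia; f_equal; apply IH; [lia|assumption|].
  intros s Hs; apply (H (S s)); lia.
Qed.

Lemma last_mark_eq u d t : (t < length u)%nat -> D (nth t u d) = false ->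
  (forall s, (t < s < length u)%nat -> D (nth s u d) = true) -> last_mark u = S t.
Proof.
  revert t; induction u as [|c u IH]; simpl; intros t Ht Dt H; [lia|].
  destruct t as [|t].
  - destruct (marked u) eqn:E; [|now rewrite Dt].
    apply (markedP u d) in E; destruct E as [s [Hs Ds]].
    pose proof (H (S s) ltac:(lia)) as E; simpl in E; congruence.
  - assert (marked u = true) as -> by (apply (markedP u d); exists t; split; [lia|assumption]).
    f_equal; apply IH; [lia|assumption|].
    intros s Hs; apply (H (S s)); lia.
Qed.

End Markers.

Inductive mark := Len | Fst | Lst.

Lemma morph_iter_nil {T : Type} (h : T -> list T) m : morph_iter h m [] = [].
Proof. induction m as [|m IH]; [reflexivity|]; now rewrite morph_iter_succ. Qed.

(** * The morphism that tracks lengths and extreme marks *)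

Section Tracking.
Context {T : Type}.
Variables (D : T -> bool) (h : T -> list T).

(** The letter carrying the mark is selected by [marked D (h c)], a test that is the same at every
    level. If no image is marked, [fst_track] keeps all lengths while [lst_track] stops at a letter
    of [last_mark] 0, in accordance with the default values of [first_mark] and [last_mark]. *)
Fixpoint fst_track (u : list T) : list (mark * T) :=
  match u with
  | [] => []
  | c :: u' => if marked D (h c) then [(Fst, c)] else (Len, c) :: fst_track u'
  end.

Fixpoint lst_track (u : list T) : list (mark * T) :=
  match u with
  | [] => []
  | c :: u' => if existsb (fun d => marked D (h d)) u'
               then (Len, c) :: lst_track u' else [(Lst, c)]
  end.

(** The image under [track] records how the length, the first mark and the last mark of
[h^(m+1) c] are obtained from those of [h^m]. *)
Definition track (x : mark * T) : list (mark * T) :=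
  match x with
  | (Len, c) => map (pair Len) (h c)
  | (Fst, c) => fst_track (h c)
  | (Lst, c) => lst_track (h c)
  end.

Definition track_weight (x : mark * T) : nat :=
  match x with
  | (Len, c) => length (h c)
  | (Fst, c) => first_mark D (h c)
  | (Lst, c) => last_mark D (h c)
  end.

(** [tracked m] describes [h^(m+1)]: marks are stable only from exponent 1 on, as a letter in [D]
    may have a marked image. *)
Definition tracked m (al : list (mark * T)) : nat := weight track_weight (morph_iter track m al).

Hypothesis stable : forall m c, marked D (morph_iter h (S m) [c]) = marked D (h c).

Lemma tracked_app m al be : tracked m (al ++ be) = (tracked m al + tracked m be)%nat.
Proof. unfold tracked; now rewrite morph_iter_app, weight_app. Qed.

Lemma tracked_nil m : tracked m [] = 0%nat.
Proof. unfold tracked; now rewrite morph_iter_nil. Qed.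

Lemma tracked_cons m x al : tracked m (x :: al) = (tracked m [x] + tracked m al)%nat.
Proof. exact (tracked_app m [x] al). Qed.

Lemma tracked_succ m x : tracked (S m) [x] = tracked m (track x).
Proof. unfold tracked; rewrite morph_iter_succ; simpl; now rewrite app_nil_r. Qed.

Lemma tracked_0 x : tracked 0 [x] = track_weight x.
Proof. unfold tracked, weight; simpl; lia. Qed.

Lemma morph_iter_cons m c (u : list T) :
  morph_iter h m (c :: u) = (morph_iter h m [c] ++ morph_iter h m u)%list.
Proof. exact (morph_iter_app h m [c] u). Qed.

Lemma morph_iter_single m c : morph_iter h (S m) [c] = morph_iter h m (h c).
Proof. rewrite morph_iter_succ; simpl; now rewrite app_nil_r. Qed.

Lemma marked_iter m u :
  marked D (morph_iter h (S m) u) = existsb (fun d => marked D (h d)) u.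
Proof.
  induction u as [|c u IH]; [now rewrite morph_iter_nil|].
  now rewrite morph_iter_cons, marked_app, IH, stable.
Qed.

Lemma tracked_letter m c :
  tracked m [(Len, c)] = length (morph_iter h (S m) [c]) /\
  tracked m [(Fst, c)] = first_mark D (morph_iter h (S m) [c]) /\
  tracked m [(Lst, c)] = last_mark D (morph_iter h (S m) [c]).
Proof.
  revert c; induction m as [|m IH]; intros c.
  - rewrite !tracked_0, morph_iter_single; repeat split.
  - assert (HL : forall u, tracked m (map (pair Len) u) = length (morph_iter h (S m) u)).
    { induction u as [|d u IHu]; [simpl; now rewrite tracked_nil, morph_iter_nil|].
      simpl map; rewrite tracked_cons, IHu, morph_iter_cons, length_app.
      now rewrite (proj1 (IH d)). }
    rewrite !tracked_succ, morph_iter_single; simpl track; split; [apply HL|].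
    split; generalize (h c); intros u.
    + induction u as [|d u IHu]; [simpl; now rewrite tracked_nil, morph_iter_nil|].
      rewrite morph_iter_cons, first_mark_app, stable; simpl.
      destruct (marked D (h d)); [apply IH|].
      rewrite tracked_cons, IHu; f_equal; apply IH.
    + induction u as [|d u IHu]; [simpl; now rewrite tracked_nil, morph_iter_nil|].
      rewrite morph_iter_cons, last_mark_app, marked_iter; simpl.
      destruct (existsb _ u); [|apply IH].
      rewrite tracked_cons, IHu; f_equal; apply IH.
Qed.

Lemma tracked_len m u : tracked m (map (pair Len) u) = length (morph_iter h (S m) u).
Proof.
  induction u as [|d u IHu]; [simpl; now rewrite tracked_nil, morph_iter_nil|].
  simpl map; rewrite tracked_cons, IHu, morph_iter_cons, length_app.
  now rewrite (proj1 (tracked_letter m d)).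
Qed.

End Tracking.

Lemma finite_mark (T : Type) : finite_type T -> finite_type (mark * T).
Proof.
  intros [l Hl]; exists (list_prod [Len; Fst; Lst] l); intros [k c].
  apply in_prod; [destruct k; simpl; tauto|apply Hl].
Qed.

(** * Positions and ancestors in the fixed point *)

Section FixedPoint.
Context {T : Type}.
Variables (h : T -> list T) (a : T) (z : nat -> T).
Hypothesis zfix : forall n i, (i < length (morph_iter h n [a]))%nat ->
  z i = nth i (morph_iter h n [a]) a.
Hypothesis growing : forall n,
  (length (morph_iter h n [a]) < length (morph_iter h (S n) [a]))%nat.

Definition level n : nat := length (morph_iter h n [a]).
Definition prefix n : list T := map z (seq 0 n).
(** The position in [z] where the factor [h^m(z l)] begins. *)
Definition pos m l : nat := length (morph_iter h m (prefix l)).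

Lemma level_0 : level 0 = 1%nat.
Proof. reflexivity. Qed.

Lemma level_succ n : level (S n) = length (flat_map h (morph_iter h n [a])).
Proof. reflexivity. Qed.

Lemma level_gt n : (n < level n)%nat.
Proof. induction n as [|n IH]; [unfold level; simpl; lia|]; pose proof (growing n); unfold level in *; lia. Qed.

Lemma level_mono m n : (m <= n)%nat -> (level m <= level n)%nat.
Proof. induction 1 as [|n _ IH]; [lia|]; pose proof (growing n); unfold level in *; lia. Qed.

Lemma length_prefix n : length (prefix n) = n.
Proof. unfold prefix; now rewrite length_map, length_seq. Qed.

Lemma nth_prefix n i : (i < n)%nat -> nth i (prefix n) a = z i.
Proof.
  intros Hi; unfold prefix.
  rewrite (nth_indep _ a (z 0%nat)) by (rewrite length_map, length_seq; lia).
  now rewrite map_nth, seq_nth by lia.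
Qed.

Lemma prefix_level n : prefix (level n) = morph_iter h n [a].
Proof.
  apply (nth_ext _ _ a a); [apply length_prefix|].
  intros i Hi; rewrite length_prefix in Hi; rewrite nth_prefix by assumption.
  now apply zfix.
Qed.

Lemma prefix_add l k : prefix (l + k) = (prefix l ++ map z (seq l k))%list.
Proof. unfold prefix; rewrite seq_app, map_app; reflexivity. Qed.

Lemma prefix_succ l : prefix (S l) = (prefix l ++ [z l])%list.
Proof. rewrite <- Nat.add_1_r; apply prefix_add. Qed.

(** As [l <= level l], [prefix l] is a prefix of [h^l(a)]; its image is then a prefix of
    [h^(m+l)(a)], itself a prefix of [z]. *)
Lemma iter_prefix m l : morph_iter h m (prefix l) = prefix (pos m l).
Proof.
  assert (Hl : (l <= level l)%nat) by (pose proof (level_gt l); lia).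
  pose proof (prefix_level (m + l)) as E; rewrite morph_iter_add, <- prefix_level in E.
  replace (level l) with (l + (level l - l))%nat in E by lia.
  rewrite prefix_add, morph_iter_app in E.
  assert (Hp : (pos m l <= level (m + l))%nat).
  { rewrite <- (length_prefix (level (m + l))), E, length_app; unfold pos; lia. }
  replace (level (m + l)) with (pos m l + (level (m + l) - pos m l))%nat in E by lia.
  rewrite prefix_add in E.
  apply (f_equal (firstn (pos m l))) in E; rewrite !firstn_app, length_prefix in E.
  fold (pos m l) in E; rewrite Nat.sub_diag in E; simpl in E; rewrite !app_nil_r in E.
  rewrite (firstn_all2 (n := pos m l) (morph_iter h m (prefix l))) in E by (unfold pos; lia).
  rewrite <- E, firstn_all2; [reflexivity|rewrite length_prefix; lia].
Qed.

Lemma pos_0 m : pos m 0 = 0%nat.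
Proof. unfold pos; change (prefix 0) with (@nil T); now rewrite morph_iter_nil. Qed.

Lemma pos_succ m l : pos m (S l) = (pos m l + length (morph_iter h m [z l]))%nat.
Proof. unfold pos; now rewrite prefix_succ, morph_iter_app, length_app. Qed.

Lemma pos_mono m l l' : (l <= l')%nat -> (pos m l <= pos m l')%nat.
Proof. induction 1 as [|l' _ IH]; [lia|]; rewrite pos_succ; lia. Qed.

Lemma pos_level m r : pos m (level r) = level (m + r).
Proof. unfold pos, level at 2; now rewrite prefix_level, morph_iter_add. Qed.

Lemma pos_1 m : pos m 1 = level m.
Proof. rewrite <- (Nat.add_0_r m) at 2; rewrite <- pos_level; reflexivity. Qed.

Lemma letter_image m l t : (t < length (morph_iter h m [z l]))%nat ->
  z (pos m l + t) = nth t (morph_iter h m [z l]) a.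
Proof.
  intros Ht; pose proof (iter_prefix m (S l)) as E.
  rewrite prefix_succ, morph_iter_app, pos_succ in E.
  rewrite <- (nth_prefix (pos m l + length (morph_iter h m [z l]))) by lia.
  rewrite <- E, app_nth2 by (fold (pos m l); lia).
  fold (pos m l); f_equal; lia.
Qed.

Lemma ancestor m p : exists l, (pos m l <= p < pos m (S l))%nat.
Proof.
  assert (H : forall l, (p < pos m l)%nat -> exists l, (pos m l <= p < pos m (S l))%nat).
  { induction l as [|l IH]; [rewrite pos_0; lia|intros Hl].
    destruct (Nat.lt_ge_cases p (pos m l)); [auto|exists l; lia]. }
  apply (H (level p)); rewrite pos_level; pose proof (level_gt (m + p)); lia.
Qed.

Variable D : T -> bool.
Hypothesis stable : forall m c, marked D (morph_iter h (S m) [c]) = marked D (h c).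

(** The block strictly between may be empty; [S P < Q] is required separately where ratios are
    formed. *)
Definition gap P Q : Prop := (P < Q)%nat /\ D (z P) = false /\ D (z Q) = false /\
  forall p, (P < p < Q)%nat -> D (z p) = true.

Lemma marked_ancestor m l p : (pos (S m) l <= p < pos (S m) (S l))%nat ->
  D (z p) = false -> marked D (h (z l)) = true.
Proof.
  intros Hp Dp; rewrite pos_succ in Hp; rewrite <- (stable m).
  apply (markedP D _ a); exists (p - pos (S m) l)%nat; split; [lia|].
  rewrite <- letter_image by lia.
  now replace (pos (S m) l + (p - pos (S m) l))%nat with p by lia.
Qed.

(** When the ancestors differ, no mark follows [P] in the image of [z l] and none precedes [Q] in
    that of [z l']. [last_mark] counts one past its letter, so the tracked value is [S P], the start
    of the block. *)
Lemma gap_tracked m P Q l l' : gap P Q ->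
  (pos (S m) l <= P < pos (S m) (S l))%nat -> (pos (S m) l' <= Q < pos (S m) (S l'))%nat ->
  (l < l')%nat ->
  S P = tracked D h m (map (pair Len) (prefix l) ++ [(Lst, z l)]) /\
  Q = tracked D h m (map (pair Len) (prefix l') ++ [(Fst, z l')]).
Proof.
  intros [PQ [DP [DQ H]]] HP HQ ll'.
  pose proof (pos_mono (S m) (S l) l' ll') as Hm.
  rewrite pos_succ in HP, HQ.
  rewrite !tracked_app, !tracked_len by exact stable; fold (pos (S m) l) (pos (S m) l').
  destruct (tracked_letter D h stable m (z l)) as [_ [_ ->]].
  destruct (tracked_letter D h stable m (z l')) as [_ [-> _]].
  rewrite (last_mark_eq D _ a (P - pos (S m) l)), (first_mark_eq D _ a (Q - pos (S m) l'));
    rewrite ?pos_succ in Hm; try lia.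
  - rewrite <- letter_image by lia.
    now replace (pos (S m) l' + (Q - pos (S m) l'))%nat with Q by lia.
  - intros s Hs; rewrite <- letter_image by lia; apply H; lia.
  - rewrite <- letter_image by lia.
    now replace (pos (S m) l + (P - pos (S m) l))%nat with P by lia.
  - intros s Hs; rewrite <- letter_image by lia; apply H; lia.
Qed.

End FixedPoint.

(** * The limit superior *)

(** [L] is the supremum of the reals exceeded infinitely often. *)
Lemma limsup_exists (u : nat -> R) (m M : R) :
  (forall N, exists k, (N <= k)%nat /\ m < u k) ->
  (exists N, forall k, (N <= k)%nat -> u k <= M) -> exists L, is_limsup u L.
Proof.
  intros Hm [N0 HM].
  set (E := fun x => forall N, exists k, (N <= k)%nat /\ x < u k).
  destruct (completeness E) as [L [Lub Lleast]].
  - exists M; intros x Hx; destruct (Hx N0) as [k [Hk Hu]]; specialize (HM k Hk); lra.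
  - exists m; exact Hm.
  - exists L; split.
    + intros eps Heps; apply NNPP; intros Hno.
      assert (HE : E (L + eps / 2)).
      { intros N; apply NNPP; intros Hk; apply Hno; exists N; intros k Hk'.
        apply Rnot_le_lt; intros Hle; apply Hk; exists k; split; [assumption|lra]. }
      apply Lub in HE; lra.
    + intros eps Heps N; apply NNPP; intros Hno.
      enough (is_upper_bound E (L - eps)) by (apply Lleast in H; lra).
      intros x Hx; destruct (Hx N) as [k [Hk Hu]].
      apply Rnot_lt_le; intros Hlt; apply Hno; exists k; split; [assumption|lra].
Qed.

Lemma limsup_clusters (u : nat -> R) L : is_limsup u L ->
  forall eps N, eps > 0 -> exists k, (N <= k)%nat /\ Rabs (u k - L) < eps.
Proof.
  intros [H1 H2] eps N Heps; destruct (H1 eps Heps) as [N1 HN1].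
  destruct (H2 eps Heps (N + N1)%nat) as [k [Hk Hu]]; exists k; split; [lia|].
  specialize (HN1 k ltac:(lia)); apply Rabs_def1; lra.
Qed.

Lemma finite_pigeonhole (A : Type) (l : list A) (P : nat -> A -> Prop) :
  (forall n x, P (S n) x -> P n x) ->
  (forall n, exists x, In x l /\ P n x) -> exists x, In x l /\ forall n, P n x.
Proof.
  intros Hdec Hex; apply NNPP; intros Hno.
  assert (Hle : forall n k x, P (n + k)%nat x -> P n x).
  { intros n k x; induction k as [|k IH]; [now rewrite Nat.add_0_r|].
    rewrite Nat.add_succ_r; auto. }
  assert (HN : forall l', incl l' l -> exists N, forall x, In x l' -> ~ P N x).
  { induction l' as [|x l' IH]; intros Hincl; [exists 0%nat; intros x []|].
    destruct IH as [N HN]; [intros y Hy; apply Hincl; now right|].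
    destruct (not_all_ex_not _ (fun n => P n x)) as [M HM].
    { intros Hall; apply Hno; exists x; split; [apply Hincl; now left|assumption]. }
    exists (N + M)%nat; intros y [<-|Hy] HS.
    - apply HM, (Hle M N); now rewrite Nat.add_comm.
    - apply (HN y Hy), (Hle N M _ HS). }
  destruct (HN l (incl_refl l)) as [N HN']; destruct (Hex N) as [x [Hx HS]].
  exact (HN' x Hx HS).
Qed.

Lemma Rdiv_lt_le (x y c : R) : 0 < y -> x <= c * y -> x / y <= c.
Proof.
  intros Hy H; apply (Rmult_le_reg_r y); [assumption|].
  unfold Rdiv; rewrite Rmult_assoc, Rinv_l; lra.
Qed.

Section Limsup.
Context {T : Type}.
Variables (h : T -> list T) (a : T) (z : nat -> T) (D : T -> bool).
Hypothesis Tfin : finite_type T.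
Hypothesis zfix : forall n i, (i < length (morph_iter h n [a]))%nat ->
  z i = nth i (morph_iter h n [a]) a.
Hypothesis growing : forall n,
  (length (morph_iter h n [a]) < length (morph_iter h (S n) [a]))%nat.
Hypothesis stable : forall m c, marked D (morph_iter h (S m) [c]) = marked D (h c).

Notation level := (level h a).
Notation prefix := (prefix z).
Notation pos := (pos h z).
Notation gap := (gap z D).

Lemma level_ratio_bound : exists C, forall n, (level (S n) <= C * level n)%nat.
Proof.
  destruct Tfin as [l Hl].
  exists (list_max (map (fun c => length (h c)) l)); intros n.
  assert (HC : forall c, (length (h c) <= list_max (map (fun c => length (h c)) l))%nat).
  { intros c; pose proof (proj1 (list_max_le (map (fun c => length (h c)) l) _) (le_n _)) as HC.
    rewrite Forall_forall in HC; apply HC, in_map_iff; eauto. }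
  rewrite level_succ; change (level n) with (length (morph_iter h n [a])).
  induction (morph_iter h n [a]) as [|c u IH]; simpl; [lia|].
  rewrite length_app; specialize (HC c); lia.
Qed.

Lemma level_bound s : exists C, forall n, (level (n + s) <= C * level n)%nat.
Proof.
  destruct level_ratio_bound as [C HC]; exists (C ^ s)%nat; intros n.
  induction s as [|s IH]; [rewrite Nat.add_0_r; simpl; lia|].
  rewrite Nat.add_succ_r; specialize (HC (n + s)%nat); simpl; nia.
Qed.

Lemma level_exists p : (1 <= p)%nat -> exists n, (level n <= p < level (S n))%nat.
Proof.
  intros Hp.
  assert (H : forall n, (p < level n)%nat -> exists n, (level n <= p < level (S n))%nat).
  { induction n as [|n IH]; [rewrite level_0; lia|]; intros Hn.
    destruct (Nat.lt_ge_cases p (level n)); [auto|exists n; lia]. }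
  apply (H p), level_gt, growing.
Qed.

Lemma letters_occur_early : exists s, forall p, exists p', (p' < level s)%nat /\ z p' = z p.
Proof.
  destruct Tfin as [l Hl].
  assert (H : forall l', exists s, forall p, In (z p) l' -> exists p', (p' < level s)%nat /\ z p' = z p).
  { induction l' as [|c l' [s IH]]; [exists 0%nat; intros p []|].
    destruct (classic (exists p, z p = c)) as [[p0 Hp0]|Hno].
    - exists (s + p0)%nat; intros p [<-|Hp].
      + exists p0; split; [|assumption].
        pose proof (level_gt h a growing (s + p0)); lia.
      + destruct (IH p Hp) as [p' [Hp' E]]; exists p'; split; [|assumption].
        pose proof (level_mono h a growing s (s + p0)); lia.
    - exists s; intros p [E|Hp]; [exfalso; eauto|auto]. }
  destruct (H l) as [s Hs]; exists s; auto.
Qed.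

(** Every letter of [z] already occurs in [h^s(a)], so its [m]-th image is a factor of
    [h^(m+s)(a)]. *)
Lemma letter_length_bound : exists s, forall m l,
  (length (morph_iter h m [z l]) <= level (m + s))%nat.
Proof.
  destruct letters_occur_early as [s Hs]; exists s; intros m l.
  destruct (Hs l) as [l' [Hl' <-]].
  rewrite <- (pos_level h a z zfix m s).
  pose proof (pos_mono h z m (S l') (level s) Hl'); rewrite pos_succ in H; lia.
Qed.

Hypothesis unbounded : forall N, exists p, (N <= p)%nat /\ D (z p) = false.

Lemma gap_ancestors r : exists Q0, forall m P Q, gap P Q ->
  (level (S m + r) <= P < level (S (S m + r)))%nat ->
  exists l l', (level r <= l < level (S r))%nat /\ (l <= l' <= Q0)%nat /\
    (pos (S m) l <= P < pos (S m) (S l))%nat /\ (pos (S m) l' <= Q < pos (S m) (S l'))%nat.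
Proof.
  destruct (unbounded (pos 1 (level (S r)))) as [p [Hp Dp]].
  destruct (ancestor h a z zfix growing 1 p) as [Q0 HQ0].
  assert (HB : marked D (h (z Q0)) = true) by (eapply (marked_ancestor h a z); eauto).
  assert (Hr : (level (S r) <= Q0)%nat).
  { destruct (Nat.le_gt_cases (level (S r)) Q0); [assumption|].
    pose proof (pos_mono h z 1 (S Q0) (level (S r)) ltac:(lia)); lia. }
  exists Q0; intros m P Q [PQ [DP [DQ H]]] HP.
  destruct (ancestor h a z zfix growing (S m) P) as [l Hl].
  destruct (ancestor h a z zfix growing (S m) Q) as [l' Hl'].
  exists l, l'.
  assert (Hlr : (l < level (S r))%nat).
  { destruct (Nat.lt_ge_cases l (level (S r))) as [|Hge]; [assumption|].
    apply (pos_mono h z (S m)) in Hge; rewrite (pos_level h a z zfix) in Hge.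
    replace (S m + S r)%nat with (S (S m + r)) in Hge by lia; lia. }
  repeat split; try lia.
  - destruct (Nat.le_gt_cases (level r) l) as [|Hgt]; [assumption|].
    apply (pos_mono h z (S m) (S l)) in Hgt; rewrite (pos_level h a z zfix) in Hgt; lia.
  - destruct (Nat.le_gt_cases l l') as [|Hgt]; [assumption|].
    apply (pos_mono h z (S m) (S l')) in Hgt; lia.
  - destruct (Nat.le_gt_cases l' Q0) as [|Hgt]; [assumption|exfalso].
    rewrite <- (stable m) in HB; apply (markedP D _ a) in HB; destruct HB as [t [Ht Dt]].
    rewrite <- (letter_image h a z zfix) in Dt by assumption.
    rewrite H in Dt; [discriminate|].
    pose proof (pos_mono h z (S m) (S l) Q0 ltac:(lia)).
    apply (pos_mono h z (S m) (S Q0)) in Hgt; rewrite pos_succ in Hgt; lia.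
Qed.

Lemma gap_level_bound : exists s, forall m P Q, gap P Q ->
  (level (S m) <= P < level (S (S m)))%nat -> (Q < level (S m + s))%nat.
Proof.
  destruct (gap_ancestors 0) as [Q0 H]; exists Q0; intros m P Q HG HP.
  destruct (H m P Q HG) as [l [l' [_ [Hll' [_ HQ]]]]]; [now rewrite Nat.add_0_r|].
  pose proof (level_gt h a growing Q0).
  pose proof (pos_mono h z (S m) (S l') (level Q0) ltac:(lia)).
  rewrite (pos_level h a z zfix) in H1; lia.
Qed.

Hypothesis dichotomy :
  (forall t, exists N, forall n, (N <= n)%nat -> (t * level (S n) <= S t * level n)%nat) \/
  (exists t, (0 < t)%nat /\ exists N, forall n, (N <= n)%nat ->
     (S t * level n <= t * level (S n))%nat).

Lemma subexponential_levels :
  (forall t, exists N, forall n, (N <= n)%nat -> (t * level (S n) <= S t * level n)%nat) ->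
  forall s eps, 0 < eps -> exists N, forall n, (N <= n)%nat ->
    INR (level (n + s)) <= (1 + eps) * INR (level n).
Proof.
  intros Hsub; induction s as [|s IH]; intros eps Heps.
  { exists 0%nat; intros n _; rewrite Nat.add_0_r; pose proof (pos_INR (level n)); nra. }
  (* For [d <= 1] one has [(1 + d)^2 <= 1 + 3 d <= 1 + eps]. *)
  set (d := Rmin (eps / 3) 1).
  assert (Hd : 0 < d <= 1 /\ d <= eps / 3).
  { unfold d; pose proof (Rmin_l (eps / 3) 1); pose proof (Rmin_r (eps / 3) 1).
    assert (0 < Rmin (eps / 3) 1) by (apply Rmin_glb_lt; lra); lra. }
  destruct (IH d ltac:(lra)) as [N HN].
  destruct (archimed_cor1 d ltac:(lra)) as [t [Ht Ht0]].
  destruct (Hsub t) as [M HM]; exists (N + M)%nat; intros n Hn.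
  specialize (HN n ltac:(lia)); specialize (HM (n + s)%nat ltac:(lia)).
  apply le_INR in HM; rewrite !mult_INR, S_INR in HM.
  rewrite Nat.add_succ_r.
  assert (Ht1 : 0 < INR t) by (now apply lt_0_INR).
  assert (H1 : INR (level (S (n + s))) <= (1 + / INR t) * INR (level (n + s))).
  { apply (Rmult_le_reg_l (INR t)); [assumption|].
    rewrite <- Rmult_assoc, Rmult_plus_distr_l, Rinv_r by lra; lra. }
  pose proof (pos_INR (level n)); pose proof (pos_INR (level (n + s))).
  assert (H2 : INR (level (S (n + s))) <= (1 + d) * INR (level (n + s))) by nra.
  apply (Rle_trans _ _ _ H2).
  apply (Rle_trans _ ((1 + d) * ((1 + d) * INR (level n)))); [nra|].
  rewrite <- Rmult_assoc; apply Rmult_le_compat_r; [assumption|nra].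
Qed.

Lemma exponential_levels t N : (0 < t)%nat ->
  (forall n, (N <= n)%nat -> (S t * level n <= t * level (S n))%nat) ->
  forall B, exists j, forall n, (N <= n)%nat -> B * INR (level n) <= INR (level (n + j)).
Proof.
  intros Ht H B; set (rho := 1 + / INR t).
  assert (Ht0 : 0 < INR t) by now apply lt_0_INR.
  assert (Hrho : 1 < rho).
  { unfold rho; pose proof (Rinv_0_lt_compat _ Ht0); lra. }
  destruct (Pow_x_infinity rho) with (b := B) as [j Hj]; [rewrite Rabs_pos_eq; lra|].
  exists j; intros n Hn; specialize (Hj j (le_n j)).
  rewrite Rabs_pos_eq in Hj by (apply pow_le; lra).
  apply (Rle_trans _ (rho ^ j * INR (level n))).
  { apply Rmult_le_compat_r; [apply pos_INR|lra]. }
  clear Hj; induction j as [|j IH]; [rewrite Nat.add_0_r; simpl; lra|].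
  rewrite Nat.add_succ_r; specialize (H (n + j)%nat ltac:(lia)).
  apply le_INR in H; rewrite !mult_INR, S_INR in H.
  assert (H1 : rho * INR (level (n + j)) <= INR (level (S (n + j)))).
  { apply (Rmult_le_reg_l (INR t)); [assumption|].
    unfold rho; rewrite <- Rmult_assoc, Rmult_plus_distr_l, Rinv_r by lra; lra. }
  simpl; rewrite Rmult_assoc; apply (Rle_trans _ (rho * INR (level (n + j)))); [|assumption].
  apply Rmult_le_compat_l; lra.
Qed.

Definition gap_start l : list (mark * T) := (map (pair Len) (prefix l) ++ [(Lst, z l)])%list.
Definition gap_end l : list (mark * T) := (map (pair Len) (prefix l) ++ [(Fst, z l)])%list.

Variable good : R -> Prop.
Hypothesis good_1 : good 1.
Hypothesis good_accumulation : forall l l' L, (1 <= l)%nat ->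
  (forall n, exists m, (n <= m)%nat /\
     Rabs ((INR (tracked D h m (gap_end l')) - 1) / INR (tracked D h m (gap_start l)) - L)
       < / (INR n + 1)) -> good L.

(** [good] is to be [algebraic] or [rational]; the analysis of the limsup is common to both, and
    only accumulation points of one pair of tracked sequences need to be [good]. *)
Theorem good_limsup (u : nat -> R) :
  (forall k, (1 <= k)%nat -> exists P Q, gap P Q /\ (k <= S P)%nat /\ (S P < Q)%nat /\
     u k = (INR Q - 1) / INR (S P)) ->
  exists L, is_limsup u L /\ good L.
Proof.
  intros Hu.
  assert (Hlow : forall k, (1 <= k)%nat -> 1 <= u k).
  { intros k Hk; destruct (Hu k Hk) as [P [Q [_ [_ [PQ ->]]]]].
    apply le_INR in PQ; rewrite (S_INR (S P)) in PQ.
    assert (0 < INR (S P)) by (apply lt_0_INR; lia).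
    apply (Rmult_le_reg_r (INR (S P))); [assumption|].
    unfold Rdiv; rewrite Rmult_assoc, Rinv_l; lra. }
  assert (Hlev : forall N, exists K, forall k, (K <= k)%nat ->
     exists n P Q, (N <= n)%nat /\ gap P Q /\ (level (S n) <= P < level (S (S n)))%nat /\
       u k = (INR Q - 1) / INR (S P)).
  { intros N; exists (S (level (S N))); intros k Hk.
    destruct (Hu k ltac:(lia)) as [P [Q [HG [HkP [PQ E]]]]].
    pose proof (level_gt h a growing (S N)).
    destruct (level_exists P ltac:(lia)) as [n Hn].
    assert (HnN : (S N <= n)%nat).
    { destruct (Nat.le_gt_cases (S N) n) as [|Hlt]; [assumption|].
      pose proof (level_mono h a growing (S n) (S N) ltac:(lia)); lia. }
    destruct n as [|n]; [lia|]; exists n, P, Q; split; [lia|split; [exact HG|split; [lia|exact E]]]. }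
  assert (Hratio : forall n P Q c, gap P Q -> (level (S n) <= P)%nat -> 0 <= c ->
     INR Q <= c * INR (level (S n)) -> (INR Q - 1) / INR (S P) <= c).
  { intros n P Q c HG HP Hc HQ; apply Rdiv_lt_le; [apply lt_0_INR; lia|].
    apply le_INR in HP; rewrite S_INR; nra. }
  destruct gap_level_bound as [s Hs].
  destruct (level_bound s) as [C HC].
  destruct (limsup_exists u 0 (INR C)) as [L HL].
  { intros N; exists (S N); split; [lia|]; specialize (Hlow (S N) ltac:(lia)); lra. }
  { destruct (Hlev 0%nat) as [K HK]; exists K; intros k Hk.
    destruct (HK k Hk) as [n [P [Q [_ [HG [HP ->]]]]]].
    apply (Hratio n); [assumption|lia|apply pos_INR|].
    specialize (Hs n P Q HG HP); specialize (HC (S n)).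
    rewrite <- mult_INR; apply le_INR; lia. }
  exists L; split; [assumption|].
  pose proof (limsup_clusters u L HL) as Hacc.
  assert (HL1 : 1 <= L).
  { apply Rnot_lt_le; intros Hlt; destruct (Hacc (1 - L) 1%nat ltac:(lra)) as [k [Hk Habs]].
    specialize (Hlow k Hk); apply Rabs_def2 in Habs; lra. }
  destruct (Rle_lt_or_eq_dec 1 L HL1) as [HL2|<-]; [|exact good_1].
  (* As [L = 1 + 2 e], a value [u k] within [e] of [L] exceeds [1 + e]. *)
  set (e := (L - 1) / 2).
  assert (He : 0 < e) by (unfold e; lra).
  destruct dichotomy as [Hsub|[t [Ht [N0 Hexp]]]].
  - exfalso; destruct (subexponential_levels Hsub s e He) as [N HN].
    destruct (Hlev N) as [K HK].
    destruct (Hacc e K He) as [k [Hk Habs]]; apply Rabs_def2 in Habs.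
    destruct (HK k Hk) as [n [P [Q [Hn [HG [HP E]]]]]].
    enough (u k <= 1 + e) by (unfold e in *; lra).
    rewrite E; apply (Hratio n); [assumption|lia|lra|].
    apply (Rle_trans _ (INR (level (S n + s)))); [|apply HN; lia].
    apply le_INR; specialize (Hs n P Q HG HP); lia.
  - destruct letter_length_bound as [s' Hs'].
    destruct (exponential_levels t N0 Ht Hexp (/ e)) as [j Hj].
    (* [s'] bounds the image of a letter by [level (S m + s')], and [j] more levels make this at
       most [e * level (S m + r)], hence at most [e * P]. So both ends of a gap in the image of a
       single letter give a ratio at most [1 + e]. *)
    set (r := (s' + j)%nat).
    destruct (gap_ancestors r) as [Q0 HQ0].
    (* The bounds on [l] and [l'] depend on [r] only, so one pair serves every precision. *)
    destruct (finite_pigeonhole _ (list_prod (seq 0 (level (S r))) (seq 0 (S Q0)))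
      (fun n p => (1 <= fst p)%nat /\ exists m, (n <= m)%nat /\
         Rabs ((INR (tracked D h m (gap_end (snd p))) - 1) /
               INR (tracked D h m (gap_start (fst p))) - L) < / (INR n + 1)))
      as [[l l'] [_ Hp]].
    + intros n p [Hp [m [Hm Habs]]]; split; [assumption|]; exists m; split; [lia|].
      apply (Rlt_trans _ _ _ Habs); rewrite S_INR; pose proof (pos_INR n).
      apply Rinv_lt_contravar; [apply Rmult_lt_0_compat|]; lra.
    + intros n; destruct (Hlev (n + N0 + S r)%nat) as [K HK].
      assert (Hmin : 0 < Rmin e (/ (INR n + 1))).
      { apply Rmin_glb_lt; [assumption|apply Rinv_0_lt_compat; pose proof (pos_INR n); lra]. }
      destruct (Hacc _ K Hmin) as [k [Hk Habs]].
      pose proof (Rmin_l e (/ (INR n + 1))); pose proof (Rmin_r e (/ (INR n + 1))).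
      destruct (HK k Hk) as [n' [P [Q [Hn' [HG [HP E]]]]]].
      set (m := (n' - r)%nat).
      assert (Em : (S n' = S m + r)%nat) by lia.
      rewrite Em in HP.
      destruct (HQ0 m P Q HG HP) as [l [l' [Hl [Hll' [HlP HlQ]]]]].
      assert (Hne : l <> l').
      { intros <-; enough (u k <= 1 + e) by (apply Rabs_def2 in Habs; unfold e in *; lra).
        rewrite E; apply Rdiv_lt_le; [apply lt_0_INR; lia|].
        specialize (Hs' (S m) l); rewrite pos_succ in HlP, HlQ.
        assert (HQP : (Q <= P + level (S m + s'))%nat) by lia.
        specialize (Hj (S m + s')%nat ltac:(lia)).
        replace (S m + s' + j)%nat with (S m + r)%nat in Hj by (unfold r; lia).
        apply le_INR in HQP; rewrite plus_INR in HQP.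
        destruct HP as [HP _]; apply le_INR in HP.
        assert (INR (level (S m + s')) <= e * INR P).
        { apply (Rmult_le_reg_l (/ e)); [now apply Rinv_0_lt_compat|].
          rewrite <- Rmult_assoc, Rinv_l; lra. }
        rewrite S_INR; lra. }
      exists (l, l'); split.
      { apply in_prod; apply in_seq; lia. }
      simpl; pose proof (level_gt h a growing r); split; [lia|].
      exists m; split; [lia|].
      destruct (gap_tracked h a z zfix growing D stable m P Q l l' HG HlP HlQ ltac:(lia)) as [E1 E2].
      unfold gap_start, gap_end; rewrite <- E1, <- E2, <- E; lra.
    + apply (good_accumulation l l'); [apply (Hp 0%nat)|intros n; apply (Hp n)].
Qed.

End Limsup.

Lemma first_mark_le {T : Type} (D : T -> bool) u : (first_mark D u <= length u)%nat.
Proof. induction u as [|c u IH]; simpl; [lia|destruct (D c); lia]. Qed.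

Lemma zpoly_eval_continuous p x : forall eps, 0 < eps -> exists d, 0 < d /\
  forall y, Rabs (y - x) < d -> Rabs (zpoly_eval p y - zpoly_eval p x) < eps.
Proof.
  assert (H : continuity (zpoly_eval p)).
  { induction p as [|c p IH].
    - apply continuity_const; intros y1 y2; reflexivity.
    - apply (continuity_plus (fun _ => IZR c) (fun y => y * zpoly_eval p y)).
      + apply continuity_const; intros y1 y2; reflexivity.
      + apply (continuity_mult id); [apply derivable_continuous, derivable_id|assumption]. }
  intros eps Heps; destruct (H x eps Heps) as [d [Hd Hy]]; exists d; split; [assumption|].
  intros y Hyx; destruct (Req_dec x y) as [<-|Hne].
  - rewrite Rminus_diag, Rabs_R0; assumption.
  - apply Hy; repeat split; assumption.
Qed.

(** [x] is the ratio of weights and [y] the same ratio with 1 subtracted from the numerator; as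
    [y - x] tends to 0, continuity of [p] at [L] suffices. *)
Lemma algebraic_accumulation p (x y : nat -> R) L :
  (exists c, In c p /\ c <> 0%Z) ->
  (forall eps, 0 < eps -> exists N, forall m, (N <= m)%nat -> Rabs (zpoly_eval p (x m)) < eps) ->
  (forall eps, 0 < eps -> exists N, forall m, (N <= m)%nat -> Rabs (y m - x m) < eps) ->
  (forall n, exists m, (n <= m)%nat /\ Rabs (y m - L) < / (INR n + 1)) ->
  algebraic L.
Proof.
  intros Hp Hx Hxy HL; exists p; split; [assumption|].
  apply NNPP; intros Hne; apply Rabs_pos_lt in Hne.
  set (eps := Rabs (zpoly_eval p L)) in *.
  destruct (zpoly_eval_continuous p L (eps / 2) ltac:(lra)) as [d [Hd Hcont]].
  destruct (Hx (eps / 2) ltac:(lra)) as [N1 HN1].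
  destruct (Hxy (d / 2) ltac:(lra)) as [N2 HN2].
  destruct (archimed_cor1 (d / 2) ltac:(lra)) as [N3 [HN3 HN3']].
  destruct (HL (N1 + N2 + N3)%nat) as [m [Hm HmL]].
  assert (Hsmall : / (INR (N1 + N2 + N3) + 1) < d / 2).
  { apply (Rle_lt_trans _ (/ INR N3)); [|assumption].
    apply Rinv_le_contravar; [now apply lt_0_INR|].
    rewrite !plus_INR; pose proof (pos_INR N1); pose proof (pos_INR N2); lra. }
  specialize (HN1 m ltac:(lia)); specialize (HN2 m ltac:(lia)).
  assert (H : Rabs (x m - L) < d).
  { replace (x m - L) with (- (y m - x m) + (y m - L)) by ring.
    apply (Rle_lt_trans _ _ _ (Rabs_triang _ _)); rewrite Rabs_Ropp; lra. }
  specialize (Hcont _ H).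
  assert (eps <= Rabs (zpoly_eval p L - zpoly_eval p (x m)) + Rabs (zpoly_eval p (x m))).
  { unfold eps; eapply Rle_trans; [|apply Rabs_triang]; right; f_equal; ring. }
  rewrite Rabs_minus_sym in H0; lra.
Qed.

(** * Algebraic accumulation points *)

Section Accumulation.
Context {T : Type}.
Variables (h : T -> list T) (a : T) (z : nat -> T) (D : T -> bool).
Hypothesis Tfin : finite_type T.
Hypothesis zfix : forall n i, (i < length (morph_iter h n [a]))%nat ->
  z i = nth i (morph_iter h n [a]) a.
Hypothesis growing : forall n,
  (length (morph_iter h n [a]) < length (morph_iter h (S n) [a]))%nat.
Hypothesis stable : forall m c, marked D (morph_iter h (S m) [c]) = marked D (h c).

(** For [1 <= l] the prefix contains [z 0], whose image has length [level (S m)]. This keeps the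
    denominators positive and unbounded. *)
Lemma gap_start_level m l : (1 <= l)%nat ->
  (level h a (S m) <= tracked D h m (gap_start z l))%nat.
Proof.
  intros Hl; unfold gap_start; rewrite tracked_app, tracked_len by exact stable.
  fold (pos h z (S m) l); rewrite <- (pos_1 h a z zfix (S m)).
  pose proof (pos_mono h z (S m) 1 l Hl); lia.
Qed.

Lemma gap_start_gt m l : (1 <= l)%nat -> (S m < tracked D h m (gap_start z l))%nat.
Proof.
  intros Hl; pose proof (gap_start_level m l Hl).
  pose proof (level_gt h a growing (S m)); lia.
Qed.

Lemma gap_end_bound l l' : (1 <= l)%nat -> exists C, forall m,
  (tracked D h m (gap_end z l') <= C * tracked D h m (gap_start z l))%nat.
Proof.
  intros Hl; destruct (level_bound h a Tfin l') as [C HC]; exists C; intros m.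
  pose proof (gap_start_level m l Hl); specialize (HC (S m)).
  enough (tracked D h m (gap_end z l') <= level h a (S m + l'))%nat by nia.
  unfold gap_end; rewrite tracked_app, tracked_len by exact stable.
  destruct (tracked_letter D h stable m (z l')) as [_ [-> _]].
  pose proof (first_mark_le D (morph_iter h (S m) [z l'])).
  pose proof (pos_succ h z (S m) l').
  pose proof (pos_mono h z (S m) (S l') (level h a l') (level_gt h a growing l')) as Hpos.
  rewrite (pos_level h a z zfix) in Hpos; fold (pos h z (S m) l'); lia.
Qed.

Lemma algebraic_gap_accumulation l l' L : (1 <= l)%nat ->
  (forall n, exists m, (n <= m)%nat /\
     Rabs ((INR (tracked D h m (gap_end z l')) - 1) / INR (tracked D h m (gap_start z l)) - L)
       < / (INR n + 1)) -> algebraic L.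
Proof.
  intros Hl HL; destruct (gap_end_bound l l' Hl) as [C HC].
  destruct (@MatrixGrowth.ratio_accumulation (mark * T)%type (track D h) (track_weight D h)
    (gap_end z l') (gap_start z l) C (finite_mark T Tfin)) as [p [Hp Hlim]].
  - intros m E; pose proof (gap_start_gt m l Hl); unfold tracked in *; lia.
  - exact HC.
  - apply (algebraic_accumulation p
      (fun m => INR (tracked D h m (gap_end z l')) / INR (tracked D h m (gap_start z l)))
      (fun m => (INR (tracked D h m (gap_end z l')) - 1) / INR (tracked D h m (gap_start z l)))
      L Hp Hlim); [|exact HL].
    intros eps Heps; destruct (archimed_cor1 eps Heps) as [N [HN HN0]]; exists N; intros m Hm.
    pose proof (gap_start_gt m l Hl) as Hgt.
    set (Y := tracked D h m (gap_start z l)) in *.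
    set (X := tracked D h m (gap_end z l')).
    assert (HY : INR N < INR Y) by (apply lt_INR; lia).
    assert (HN1 : 0 < INR N) by now apply lt_0_INR.
    replace ((INR X - 1) / INR Y - INR X / INR Y) with (- / INR Y) by (field; lra).
    rewrite Rabs_Ropp, Rabs_pos_eq by (left; apply Rinv_0_lt_compat; lra).
    apply (Rlt_trans _ (/ INR N)); [|assumption].
    apply Rinv_lt_contravar; [apply Rmult_lt_0_compat|]; lra.
Qed.

End Accumulation.

Lemma length_uniform_iter {T : Type} (h : T -> list T) mu :
  (forall c, length (h c) = mu) ->
  forall m u, length (morph_iter h m u) = (length u * mu ^ m)%nat.
Proof.
  intros Hmu m; induction m as [|m IH]; intros u; [simpl; lia|].
  rewrite morph_iter_succ, IH.
  replace (length (flat_map h u)) with (length u * mu)%nat; [simpl; ring|].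
  induction u as [|c u IHu]; simpl; [reflexivity|rewrite length_app, Hmu; lia].
Qed.

(** * Uniform morphisms and rational accumulation points *)

Section Uniform.
Variable mu : nat.
Hypothesis mu_gt1 : (1 < mu)%nat.

Definition rational_rate (f : nat -> nat) : Prop :=
  exists (b c : Z) (K : R), (0 < b)%Z /\
    forall m, Rabs (IZR b * INR (f m) - IZR c * INR mu ^ m) <= K.

Lemma rational_rate_ext f g : (forall m, f m = g m) -> rational_rate f -> rational_rate g.
Proof.
  intros E [b [c [K [Hb H]]]]; exists b, c, K; split; [assumption|].
  intros m; rewrite <- E; apply H.
Qed.

Lemma rational_rate_pow y : rational_rate (fun m => y * mu ^ m)%nat.
Proof.
  exists 1%Z, (Z.of_nat y), 0; split; [lia|]; intros m.
  rewrite mult_INR, pow_INR, <- INR_IZR_INZ.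
  replace (_ - _) with 0 by ring; rewrite Rabs_R0; lra.
Qed.

Lemma rational_rate_plus f g : rational_rate f -> rational_rate g ->
  rational_rate (fun m => f m + g m)%nat.
Proof.
  intros [b [c [K [Hb H]]]] [b' [c' [K' [Hb' H']]]].
  exists (b * b')%Z, (c * b' + c' * b)%Z, (K * IZR b' + K' * IZR b); split; [lia|]; intros m.
  specialize (H m); specialize (H' m); rewrite plus_INR, plus_IZR, !mult_IZR.
  apply IZR_lt in Hb, Hb'.
  replace (_ - _) with ((IZR b * INR (f m) - IZR c * INR mu ^ m) * IZR b' +
    (IZR b' * INR (g m) - IZR c' * INR mu ^ m) * IZR b) by ring.
  eapply Rle_trans; [apply Rabs_triang|]; rewrite !Rabs_mult.
  rewrite (Rabs_pos_eq (IZR b)), (Rabs_pos_eq (IZR b')) by lra.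
  apply Rplus_le_compat; apply Rmult_le_compat_r; lra.
Qed.

Lemma rational_rate_shift f : rational_rate (fun m => f (S m)) -> rational_rate f.
Proof.
  intros [b [c [K [Hb H]]]].
  (* The last summand of the bound absorbs the value at 0, about which the shifted sequence says
     nothing. *)
  exists (b * Z.of_nat mu)%Z, c, (K * INR mu + Rabs (IZR (b * Z.of_nat mu) * INR (f 0%nat) - IZR c)).
  split; [lia|]; intros m.
  assert (Hmu : 0 <= INR mu) by apply pos_INR.
  pose proof (Rabs_pos (IZR (b * Z.of_nat mu) * INR (f 0%nat) - IZR c)) as Hpos.
  destruct m as [|m].
  - simpl; rewrite Rmult_1_r.
    assert (0 <= K) by (eapply Rle_trans; [apply Rabs_pos|apply (H 0%nat)]); nra.
  - rewrite mult_IZR, <- INR_IZR_INZ; simpl pow.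
    replace (_ - _) with ((IZR b * INR (f (S m)) - IZR c * INR mu ^ m) * INR mu) by ring.
    rewrite Rabs_mult, (Rabs_pos_eq (INR mu)) by assumption.
    specialize (H m); rewrite mult_IZR, <- INR_IZR_INZ in Hpos; nra.
Qed.

Lemma periodic_bounded (g : nat -> R) t : (1 <= t)%nat -> (forall m, g (m + t)%nat = g m) ->
  exists K, forall m, Rabs (g m) <= K.
Proof.
  intros Ht Hg.
  assert (H : forall n, exists K, forall m, (m < n)%nat -> Rabs (g m) <= K).
  { induction n as [|n [K HK]]; [exists 0; lia|].
    exists (Rmax K (Rabs (g n))); intros m Hm.
    destruct (Nat.eq_dec m n) as [->|]; [apply Rmax_r|].
    eapply Rle_trans; [apply HK; lia|apply Rmax_l]. }
  destruct (H t) as [K HK]; exists K; intros m.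
  induction m as [m IH] using lt_wf_ind.
  destruct (Nat.lt_ge_cases m t); [auto|].
  replace m with (m - t + t)%nat by lia; rewrite Hg; apply IH; lia.
Qed.

(** Multiplying by [mu ^ t - 1] turns the geometric growth along a cycle into an exact
geometric term plus a periodic error. *)
Lemma rational_rate_cycle f t y : (1 <= t)%nat ->
  (forall m, f (m + t)%nat = (y * mu ^ m + f m)%nat) -> rational_rate f.
Proof.
  intros Ht Hf; set (b := (Z.of_nat (mu ^ t) - 1)%Z).
  assert (Hb : IZR b = INR mu ^ t - 1).
  { unfold b; rewrite minus_IZR, <- INR_IZR_INZ, pow_INR; reflexivity. }
  destruct (periodic_bounded (fun m => IZR b * INR (f m) - IZR (Z.of_nat y) * INR mu ^ m) t Ht)
    as [K HK].
  - intros m; rewrite Hf, Hb, plus_INR, mult_INR, pow_INR, <- INR_IZR_INZ, pow_add; ring.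
  - exists b, (Z.of_nat y), K; split; [|exact HK].
    assert (1 < mu ^ t)%nat; [|unfold b; lia].
    apply Nat.pow_gt_1; lia.
Qed.

(** Each state passes to at most one other. The walk from [x] ends in a pure geometric term or
    returns to a visited state, where [rational_rate_cycle] applies; [vis] remembers how each
    visited state reached the current one, and [fuel] runs out only after more distinct states than
    [l] has entries. *)
Lemma rational_rate_finite {U : Type} (f : U -> nat -> nat) : finite_type U ->
  (forall x, exists y, (forall m, f x (S m) = y * mu ^ m)%nat \/
     exists x', forall m, f x (S m) = (y * mu ^ m + f x' m)%nat) ->
  forall x, rational_rate (f x).
Proof.
  intros [l Hl] Hstep.
  enough (H : forall fuel vis x, NoDup vis -> (length l < length vis + fuel)%nat ->
    (forall v, In v vis -> exists t y, (1 <= t)%nat /\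
       forall m, f v (m + t)%nat = (y * mu ^ m + f x m)%nat) -> rational_rate (f x)).
  { intros x; apply (H (S (length l)) nil); [constructor|simpl; lia|intros v []]. }
  induction fuel as [|fuel IH]; intros vis x Hnd Hlen Hvis.
  { pose proof (NoDup_incl_length Hnd (fun v _ => Hl v)); lia. }
  destruct (classic (In x vis)) as [Hx|Hx].
  { destruct (Hvis x Hx) as [t [y [Ht E]]]; exact (rational_rate_cycle _ t y Ht E). }
  destruct (Hstep x) as [y [E|[x' E]]]; apply rational_rate_shift.
  - apply (rational_rate_ext _ _ (fun m => eq_sym (E m))), rational_rate_pow.
  - apply (rational_rate_ext _ _ (fun m => eq_sym (E m))), rational_rate_plus.
    + apply rational_rate_pow.
    + apply (IH (x :: vis)); [now constructor|simpl; lia|].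
      intros v [<-|Hv].
      * exists 1%nat, y; split; [lia|]; intros m; rewrite Nat.add_1_r; apply E.
      * destruct (Hvis v Hv) as [t [y' [Ht E']]].
        (* The term [y' * mu ^ m] is read one level later, which multiplies it by [mu], and the new
           step adds [y * mu ^ m]. *)
        exists (S t), (y' * mu + y)%nat; split; [lia|]; intros m.
        rewrite Nat.add_succ_r, <- Nat.add_succ_l, E', E; simpl; ring.
Qed.

Lemma rational_ratio_accumulation (X Y : nat -> nat) L :
  rational_rate X -> rational_rate Y -> (forall m, (S m < Y m)%nat) ->
  (forall n, exists m, (n <= m)%nat /\ Rabs ((INR (X m) - 1) / INR (Y m) - L) < / (INR n + 1)) ->
  rational L.
Proof.
  intros [b [c [K [Hb HX]]]] [b' [c' [K' [Hb' HY]]]] HmY HL.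
  apply IZR_lt in Hb, Hb'.
  (* Otherwise [b' * Y m] would be at most [K'], whereas [Y m > m + 1]. *)
  assert (Hc' : 0 < IZR c').
  { apply Rnot_le_lt; intros Hle.
    destruct (INR_unbounded (K' / IZR b')) as [m Hm].
    specialize (HY m); specialize (HmY m); apply lt_INR in HmY; rewrite S_INR in HmY.
    assert (IZR b' * INR (Y m) <= K').
    { eapply Rle_trans; [|exact HY]; eapply Rle_trans; [|apply Rle_abs].
      pose proof (pow_le (INR mu) m (pos_INR mu)); nra. }
    apply (Rmult_lt_compat_l (IZR b')) in Hm; [|assumption].
    replace (IZR b' * (K' / IZR b')) with K' in Hm by (field; lra); nra. }
  exists (c * b')%Z, (b * c')%Z; rewrite !mult_IZR; split.
  { intros E; apply (f_equal IZR) in E; rewrite mult_IZR in E; simpl in E; nra. }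
  set (q := IZR c * IZR b' / (IZR b * IZR c')).
  apply NNPP; intros Hne; apply Rminus_eq_contra, Rabs_pos_lt in Hne.
  set (d := Rabs (L - q)) in *.
  (* Eliminating [mu ^ m] between the two rates bounds [b c' (X - 1 - q Y)] by [K2], where the last
     summand comes from the subtracted 1. Thus the distance from the ratio to [q] is [O(1 / Y)]. *)
  set (K2 := IZR c' * K + Rabs (IZR c) * K' + IZR b * IZR c').
  assert (Hbc : 0 < IZR b * IZR c') by now apply Rmult_lt_0_compat.
  assert (Hclose : forall m, Rabs ((INR (X m) - 1) / INR (Y m) - q) * INR (Y m)
      <= K2 / (IZR b * IZR c')).
  { intros m; specialize (HX m); specialize (HY m); specialize (HmY m).
    assert (HY0 : 0 < INR (Y m)) by (apply lt_0_INR; lia).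
    rewrite <- (Rabs_pos_eq (INR (Y m))) at 2 by lra; rewrite <- Rabs_mult.
    apply (Rmult_le_reg_l (IZR b * IZR c')); [assumption|].
    replace (IZR b * IZR c' * (K2 / (IZR b * IZR c'))) with K2 by (field; lra).
    rewrite <- (Rabs_pos_eq (IZR b * IZR c')) at 1 by lra; rewrite <- Rabs_mult.
    replace (IZR b * IZR c' * (((INR (X m) - 1) / INR (Y m) - q) * INR (Y m))) with
      (IZR c' * (IZR b * INR (X m) - IZR c * INR mu ^ m) +
       - (IZR c * (IZR b' * INR (Y m) - IZR c' * INR mu ^ m)) + - (IZR b * IZR c'))
      by (unfold q; field; lra).
    eapply Rle_trans; [apply Rabs_triang|]; apply Rplus_le_compat.
    - eapply Rle_trans; [apply Rabs_triang|]; rewrite Rabs_Ropp, !Rabs_mult.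
      rewrite (Rabs_pos_eq (IZR c')) by lra.
      apply Rplus_le_compat; apply Rmult_le_compat_l; try assumption; [lra|apply Rabs_pos].
    - rewrite Rabs_Ropp, Rabs_pos_eq; lra. }
  destruct (INR_unbounded (2 * (K2 / (IZR b * IZR c')) / d)) as [N1 HN1].
  destruct (archimed_cor1 (d / 2) ltac:(lra)) as [N2 [HN2 HN2']].
  destruct (HL (N1 + N2)%nat) as [m [Hm HmL]].
  specialize (Hclose m); specialize (HmY m).
  assert (HYm : INR N1 < INR (Y m)) by (apply lt_INR; lia).
  assert (Hs : / (INR (N1 + N2) + 1) < d / 2).
  { apply (Rle_lt_trans _ (/ INR N2)); [|assumption].
    apply Rinv_le_contravar; [now apply lt_0_INR|].
    rewrite plus_INR; pose proof (pos_INR N1); lra. }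
  assert (Hd2 : d / 2 < Rabs ((INR (X m) - 1) / INR (Y m) - q)).
  { assert (d <= Rabs (L - (INR (X m) - 1) / INR (Y m)) + Rabs ((INR (X m) - 1) / INR (Y m) - q)).
    { unfold d; eapply Rle_trans; [|apply Rabs_triang]; right; f_equal; ring. }
    rewrite Rabs_minus_sym in H; lra. }
  assert (HN : 2 * (K2 / (IZR b * IZR c')) < d * INR (Y m)).
  { apply (Rmult_lt_reg_r (/ d)); [now apply Rinv_0_lt_compat|].
    replace (d * INR (Y m) * / d) with (INR (Y m)) by (field; lra).
    unfold Rdiv in HN1 at 1; lra. }
  pose proof (pos_INR (Y m)); nra.
Qed.

Context {T : Type}.
Variables (h : T -> list T) (a : T) (z : nat -> T) (D : T -> bool).
Hypothesis Tfin : finite_type T.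
Hypothesis zfix : forall n i, (i < length (morph_iter h n [a]))%nat ->
  z i = nth i (morph_iter h n [a]) a.
Hypothesis growing : forall n,
  (length (morph_iter h n [a]) < length (morph_iter h (S n) [a]))%nat.
Hypothesis stable : forall m c, marked D (morph_iter h (S m) [c]) = marked D (h c).
Hypothesis uniform_mu : forall c, length (h c) = mu.

Lemma fst_track_split u : exists y, fst_track D h u = map (pair Len) y \/
  exists c, fst_track D h u = (map (pair Len) y ++ [(Fst, c)])%list.
Proof.
  induction u as [|c u [y IH]]; [exists []; now left|]; simpl.
  destruct (marked D (h c)); [exists []; right; now exists c|].
  exists (c :: y); destruct IH as [->|[d ->]]; [now left|right; now exists d].
Qed.

Lemma lst_track_split u : exists y, lst_track D h u = map (pair Len) y \/
  exists c, lst_track D h u = (map (pair Len) y ++ [(Lst, c)])%list.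
Proof.
  induction u as [|c u [y IH]]; [exists []; now left|]; simpl.
  destruct (existsb _ u); [|exists []; right; now exists c].
  exists (c :: y); destruct IH as [->|[d ->]]; [now left|right; now exists d].
Qed.

(** The image of a letter under [track] consists of [Len] letters and at most one further letter. By
    uniformity the former contribute exactly a multiple of [mu ^ m], so the latter gives the single
    successor state. *)
Lemma tracked_rational_rate al : rational_rate (fun m => tracked D h m al).
Proof.
  assert (Hlen : forall m y, tracked D h m (map (pair Len) y) = (length y * mu * mu ^ m)%nat).
  { intros m y; rewrite tracked_len, (length_uniform_iter h mu uniform_mu) by exact stable; simpl; ring. }
  assert (Hone : forall x, rational_rate (fun m => tracked D h m [x])).
  { apply (rational_rate_finite (fun x m => tracked D h m [x])); [now apply finite_mark|].
    intros x.
    assert (Hsplit : exists y, track D h x = map (pair Len) y \/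
      exists x', track D h x = (map (pair Len) y ++ [x'])%list).
    { destruct x as [[| |] c]; simpl.
      - exists (h c); now left.
      - destruct (fst_track_split (h c)) as [y [E|[d E]]]; exists y; eauto.
      - destruct (lst_track_split (h c)) as [y [E|[d E]]]; exists y; eauto. }
    destruct Hsplit as [y Hy]; exists (length y * mu)%nat.
    destruct Hy as [E|[x' E]]; [left|right; exists x'];
      intros m; rewrite tracked_succ, E, ?tracked_app, Hlen; reflexivity. }
  induction al as [|x al IH].
  - apply (rational_rate_ext (fun m => 0 * mu ^ m)%nat); [|apply rational_rate_pow].
    intros m; rewrite tracked_nil; reflexivity.
  - apply (rational_rate_ext (fun m => tracked D h m [x] + tracked D h m al)%nat).
    + intros m; now rewrite (tracked_cons D h m x al).
    + now apply rational_rate_plus.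
Qed.

Lemma rational_gap_accumulation l l' L : (1 <= l)%nat ->
  (forall n, exists m, (n <= m)%nat /\
     Rabs ((INR (tracked D h m (gap_end z l')) - 1) / INR (tracked D h m (gap_start z l)) - L)
       < / (INR n + 1)) -> rational L.
Proof.
  intros Hl HL.
  refine (rational_ratio_accumulation _ _ L (tracked_rational_rate _)
    (tracked_rational_rate _) _ HL).
  intros m; now apply (gap_start_gt h a).
Qed.

End Uniform.

(** * Passage to a power of the morphism and to maximal blocks *)

Section Powers.
Context {T : Type}.
Variables (h : T -> list T) (q : nat).

Definition morph_power (c : T) : list T := morph_iter h q [c].

Lemma flat_map_power u : flat_map morph_power u = morph_iter h q u.
Proof.
  induction u as [|c u IH]; simpl; [now rewrite morph_iter_nil|].
  now rewrite IH, (morph_iter_cons h q c u).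
Qed.

Lemma morph_iter_power m u : morph_iter morph_power m u = morph_iter h (q * m) u.
Proof.
  revert u; induction m as [|m IH]; intros u; [now rewrite Nat.mul_0_r|].
  rewrite morph_iter_succ, IH, flat_map_power, <- morph_iter_add; f_equal; lia.
Qed.

End Powers.

Lemma fixed_point_growing {T : Type} (h : T -> list T) a : prolongable h a -> forall m n,
  (m < n)%nat -> (length (morph_iter h m [a]) < length (morph_iter h n [a]))%nat.
Proof.
  intros [x [Ha Hx]].
  assert (H : forall n, (length (morph_iter h n [a]) < length (morph_iter h (S n) [a]))%nat).
  { intros n; rewrite morph_iter_single, Ha, (morph_iter_cons h n a x), length_app.
    enough (length (morph_iter h n x) <> 0%nat) by lia.
    intros E; apply length_zero_iff_nil in E; exact (Hx n E). }
  intros m n; induction 1 as [|n _ IH]; [apply H|]; specialize (H n); lia.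
Qed.

Lemma weight_unmarked {T : Type} (D : T -> bool) u :
  weight (fun d => if D d then 0 else 1)%nat u = 0%nat <-> marked D u = false.
Proof.
  unfold weight, marked; induction u as [|c u IH]; simpl; [tauto|].
  destruct (D c); simpl; [exact IH|split; intros; [lia|discriminate]].
Qed.

Lemma weight_length {T : Type} (u : list T) : weight (fun _ => 1%nat) u = length u.
Proof. unfold weight; induction u as [|c u IH]; simpl in *; congruence. Qed.

(** The reduction common to both claims: [h] becomes its [q]-th power, which fixes the same [z], and
    a maximal block from [i >= 1] to [j] becomes the gap from [i - 1] to [j + 1]. *)
Lemma block_limsup (Sigma : Type) (w : nat -> Sigma) (D : Sigma -> bool) (bi bj : nat -> nat)
  (T : Type) (h : T -> list T) (a : T) (tau : T -> Sigma) (z : nat -> T) (good : R -> Prop) :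
  finite_type T -> is_fixed_point_word h a z -> (forall i, w i = tau (z i)) ->
  (forall N, exists p, (p >= N)%nat /\ D (w p) = false) ->
  enumerates_max_blocks w D bi bj ->
  good 1 ->
  (forall q, (0 < q)%nat ->
    let H := morph_power h q in let E := fun c => D (tau c) in
    (forall n i, (i < length (morph_iter H n [a]))%nat -> z i = nth i (morph_iter H n [a]) a) ->
    (forall n, (length (morph_iter H n [a]) < length (morph_iter H (S n) [a]))%nat) ->
    (forall m c, marked E (morph_iter H (S m) [c]) = marked E (H c)) ->
    forall l l' L, (1 <= l)%nat ->
    (forall n, exists m, (n <= m)%nat /\
      Rabs ((INR (tracked E H m (gap_end z l')) - 1) / INR (tracked E H m (gap_start z l)) - L)
        < / (INR n + 1)) -> good L) ->
  exists L, is_limsup (fun k => INR (bj k) / INR (bi k)) L /\ good L.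
Proof.
  intros Tfin [Hpro Hz] Hw Hinf [Hbi Hblocks] Hgood1 Hgood.
  destruct (@MatrixGrowth.stable_power T h a Tfin) as [q [Hq Hpow]].
  specialize (Hgood q Hq); simpl in Hgood.
  set (H := morph_power h q) in *; set (E := fun c => D (tau c)) in *.
  assert (Hfix : forall n i, (i < length (morph_iter H n [a]))%nat ->
    z i = nth i (morph_iter H n [a]) a).
  { intros n i; unfold H; rewrite morph_iter_power; apply Hz. }
  assert (Hgrow : forall n, (length (morph_iter H n [a]) < length (morph_iter H (S n) [a]))%nat).
  { intros n; unfold H; rewrite !morph_iter_power; apply fixed_point_growing; [assumption|nia]. }
  assert (Hstable : forall m c, marked E (morph_iter H (S m) [c]) = marked E (H c)).
  { intros m c; unfold H; rewrite morph_iter_power.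
    destruct (Hpow (fun d => if E d then 0 else 1)%nat) as [Hs _].
    specialize (Hs [c] m); rewrite !weight_unmarked in Hs; unfold morph_power.
    destruct (marked E (morph_iter h q [c])), (marked E (morph_iter h (q * S m) [c]));
      intuition congruence. }
  apply (good_limsup H a z E Tfin Hfix Hgrow Hstable); [| |exact Hgood1| |].
  - intros N; destruct (Hinf N) as [p [Hp Dp]]; exists p; split; [assumption|].
    unfold E; now rewrite <- Hw.
  - destruct (Hpow (fun _ => 1%nat)) as [_ Hd]; specialize (Hd [a]).
    unfold level, H; setoid_rewrite morph_iter_power.
    setoid_rewrite weight_length in Hd; apply Hd.
    intros m; destruct m as [|m]; [rewrite Nat.mul_0_r; simpl; lia|].
    pose proof (fixed_point_growing h a Hpro 0 (q * S m) ltac:(nia)); lia.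
  - exact (Hgood Hfix Hgrow Hstable).
  - assert (Hk : forall k, (k <= bi k)%nat).
    { induction k as [|k IH]; [lia|]; specialize (Hbi k); lia. }
    intros k Hk1; specialize (Hk k).
    (* Since [k <= bi k], for [k >= 1] the block starts after position 0 and has a left neighbour
       outside [D]. Only [k = 0] can have denominator 0, and it does not affect the limsup. *)
    destruct (proj2 (Hblocks (bi k) (bj k)) (ex_intro _ k (conj eq_refl eq_refl)))
      as [[Hij Hin] [Hj [Hi|Hi]]]; [lia|].
    exists (pred (bi k)), (S (bj k)); unfold gap, E; rewrite <- !Hw.
    rewrite (Nat.lt_succ_pred 0) by lia.
    repeat split; try lia; try assumption.
    + intros p Hp; rewrite <- Hw; apply Hin; lia.
    + rewrite S_INR; f_equal; lra.
Qed.

Theorem theorem20 (Sigma : Type) (w : nat -> Sigma) (D : Sigma -> bool)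
  (bi bj : nat -> nat) :
  finite_type Sigma ->
  morphic w ->
  (exists a, D a = true) ->
  (exists b, D b = false) ->
  (forall N, exists p, (p >= N)%nat /\ D (w p) = false) ->
  (forall n, exists i j, delta_block w D i j /\ (j - i + 1 >= n)%nat) ->
  enumerates_max_blocks w D bi bj ->
  (exists L, is_limsup (fun k => INR (bj k) / INR (bi k)) L /\ algebraic L) /\
  (automatic w ->
   exists L, is_limsup (fun k => INR (bj k) / INR (bi k)) L /\ rational L).
Proof.
  intros _ [T [h [a [tau [z [Tfin [Hfix Hw]]]]]]] _ _ Hinf _ Hblocks; split.
  - apply (block_limsup Sigma w D bi bj T h a tau z algebraic Tfin Hfix Hw Hinf Hblocks).
    + exists [(-1)%Z; 1%Z]; split; [exists 1%Z; simpl; split; [tauto|discriminate]|].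
      unfold zpoly_eval; simpl; ring.
    + intros q _ H E Hz Hgrow Hstable l l' L; now apply (algebraic_gap_accumulation H a).
  (* The uniform morphism may differ from the one given by [morphic], so the reduction is run afresh
     on it. *)
  - clear T h a tau z Tfin Hfix Hw.
    intros [T [h [a [tau [z [Tfin [[mu Hmu] [Hfix Hw]]]]]]]].
    apply (block_limsup Sigma w D bi bj T h a tau z rational Tfin Hfix Hw Hinf Hblocks).
    + exists 1%Z, 1%Z; split; [discriminate|field].
    + intros q Hq H E Hz Hgrow Hstable l l' L.
      assert (HU : forall c, length (H c) = (mu ^ q)%nat).
      { intros c; unfold H, morph_power; rewrite (length_uniform_iter h mu Hmu); simpl; lia. }
      apply (rational_gap_accumulation (mu ^ q)%nat) with (a := a); try assumption.
      (* Growth from level 0 to level 1 says [1 < mu ^ q], the length of the images under the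
         power. *)
      specialize (Hgrow 0%nat); simpl in Hgrow.
      rewrite app_nil_r, HU in Hgrow; exact Hgrow.
Qed.
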